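(* Let $(\Omega,\alpha)$ be a measure space such that $\alpha(\Omega)=a$ is finite and positive, and let $k$ be a positive integer. Select random variables $(M,X,W)$ as follows. 1. $M=(M_1,\ldots,M_k)\in\mathbb{N}^k$ satisfies $M_1+2M_2+\cdots+kM_k=k$ and has the Ewens distribution with parameters $k$ and $a$: for $(m_1,\ldots,m_k)\in\mathbb{N}^k$ with $m_1+2m_2+\cdots+km_k=k$, $$\Pr\big((M_1,\ldots,M_k)=(m_1,\ldots,m_k)\big)=C(m)\frac{a^{\sum_{j=1}^km_j}}{(a)_k},\qquad C(m)=\frac{k!}{\prod_{j=1}^kj^{m_j}m_j!}.$$ Denote $S_0=0$, $S_j=M_1+\cdots+M_j$, and $B(M)=(b_t)_{t=1}^{S_k}$ where $b_t=j$ for $S_{j-1}<t\le S_j$. 2. Given $M$, $X=(X_t)_{t=1}^{S_k}$ are i.i.d. random variables in $\Omega$ with $X_t\sim\alpha/a$. 3. Given $M$, $W=(W_t)_{t=1}^{S_k}\sim\mathcal{D}(B(M))$. 4. Conditionally on $M$, the random variables $X$ and $W$ are independent. Then the random probability $P=\sum_{t=1}^{S_k}W_t\delta_{X_t}$ on $\Omega$ satisfies: for any measurable partition $(A_0,\ldots,A_d)$ of $\Omega$, $$(P(A_0),\ldots,P(A_d))\sim\mathcal{B}_k(\alpha(A_0),\ldots,\alpha(A_d)).$$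
   Context: $\mathbb{N}=\{0,1,2,\ldots\}$; $(c)_0=1$, $(c)_{n+1}=(c)_n(c+n)$; $U\sim\mu$ means that $U$ has law $\mu$; $\delta_x$ is the Dirac mass at $x$. $E_{d+1}$ is the set of $\lambda\in\mathbb{R}^{d+1}$ with $\lambda_i\ge0$ and $\lambda_0+\cdots+\lambda_d=1$; its vertices are the natural basis vectors $e_0,\ldots,e_d$. For positive $a_0,\ldots,a_d$, the Dirichlet distribution $\mathcal{D}(a_0,\ldots,a_d)$ is the law on $E_{d+1}$ of $X=(X_0,\ldots,X_d)$ with $X_0=1-X_1-\cdots-X_d$ such that $(X_1,\ldots,X_d)$ has density $\frac{\Gamma(a_0+\cdots+a_d)}{\Gamma(a_0)\cdots\Gamma(a_d)}(1-x_1-\cdots-x_d)^{a_0-1}x_1^{a_1-1}\cdots x_d^{a_d-1}$ on the set where $x_1,\ldots,x_d>0$ and $x_1+\cdots+x_d<1$ (with a single parameter it is the Dirac mass at $1$). If $b_0,\ldots,b_d\ge0$ are not all zero and $T=\{i: b_i>0\}$, then $\mathcal{D}(b_0,\ldots,b_d)$ denotes the Dirichlet distribution with parameters $(b_i)_{i\in T}$ concentrated on the convex hull of $(e_i)_{i\in T}$ (coordinates with index outside $T$ are $0$); if $T=\{i_0\}$ it is $\delta_{e_{i_0}}$. The quasi Bernoulli distribution of order $k$ is the probability on $E_{d+1}$ $$\mathcal{B}_k(a_0,\ldots,a_d)=\frac{k!}{(a)_k}\sum_{(b_0,\ldots,b_d)\in\mathbb{N}^{d+1};\ b_0+\cdots+b_d=k}\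 \prod_{i=0}^d\frac{(a_i)_{b_i}}{b_i!}\ \mathcal{D}(b_0,\ldots,b_d),\qquad a=a_0+\cdots+a_d>0;$$ the same formula is used when some $a_i=0$ (then only terms with $b_i=0$ contribute). *)

(* Defs.v *)
From HB Require Import structures.
From mathcomp Require Import all_boot all_order all_algebra.
From mathcomp Require Import all_classical all_reals all_analysis.

Set Implicit Arguments.
Unset Strict Implicit.
Unset Printing Implicit Defensive.

Import Order.TTheory GRing.Theory Num.Theory.
Import numFieldNormedType.Exports.

Local Open Scope classical_set_scope.
Local Open Scope ring_scope.

(* Lebesgue measure on R^n, with R^n represented by [n.-tuple R]: the image of
   the product of the Lebesgue measures on R and R^n under (x, y) |-> x :: y. *)
Section lebesgue_cons.
Context {R : realType} {n : nat}.
Variable mu : {sigma_finite_measure set (n.-tuple R) -> \bar R}.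

Definition tcons (p : R * n.-tuple R) : n.+1.-tuple R := [tuple of p.1 :: p.2].

Lemma measurable_tcons : measurable_fun [set: R * n.-tuple R] tcons.
Proof. exact: measurable_cons. Qed.

Definition lebesgue_cons : set (n.+1.-tuple R) -> \bar R :=
  pushforward (@lebesgue_measure R \x mu)%E tcons.

Let lebesgue_cons0 : lebesgue_cons set0 = 0%E.
Proof. by rewrite /lebesgue_cons /pushforward preimage_set0 measure0. Qed.

Let lebesgue_cons_ge0 A : (0 <= lebesgue_cons A)%E.
Proof. exact: (measure_ge0 (lebesgue_measure \x mu)%E). Qed.

Let lebesgue_cons_sigma_additive : semi_sigma_additive lebesgue_cons.
Proof.
move=> F mF tF mUF; rewrite /lebesgue_cons /pushforward preimage_bigcup.
apply: measure_semi_sigma_additive.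
- by move=> i; rewrite -[X in measurable X]setTI; exact: measurable_tcons.
- apply/trivIsetP => /= i j _ _ ij; rewrite -preimage_setI.
  by move/trivIsetP : tF => /(_ _ _ _ _ ij) ->//; rewrite preimage_set0.
- by rewrite -preimage_bigcup -[X in measurable X]setTI; exact: measurable_tcons.
Qed.

HB.instance Definition _ := isMeasure.Build _ _ _ lebesgue_cons
  lebesgue_cons0 lebesgue_cons_ge0 lebesgue_cons_sigma_additive.

Let lebesgue_cons_sigma_finite : sigma_finite setT lebesgue_cons.
Proof.
have /sigma_finiteP[F [TF ndF Foo]] := sigma_finiteT (@lebesgue_measure R).
have /sigma_finiteP[G [TG ndG Goo]] := sigma_finiteT mu.
pose behead_t (x : n.+1.-tuple R) : n.-tuple R := [tuple of behead x].
exists (fun i => (fun x => tnth x ord0) @^-1` F i `&` behead_t @^-1` G i).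
  apply/esym; rewrite -subTset => x _.
  have [i _ Fi] : (\bigcup_i F i) (tnth x ord0) by rewrite -TF.
  have [j _ Gj] : (\bigcup_i G i) (behead_t x) by rewrite -TG.
  exists (maxn i j) => //; split.
  - by have /subsetPset := ndF _ _ (leq_maxl i j); exact.
  - by have /subsetPset := ndG _ _ (leq_maxr i j); exact.
move=> i; have [mF Fioo] := Foo i; have [mG Gioo] := Goo i; split.
  apply: measurableI; rewrite -[X in measurable X]setTI.
  - exact: measurable_tnth.
  - exact: measurable_behead.
rewrite /lebesgue_cons /pushforward (_ : _ @^-1` _ = F i `*` G i); last first.
  apply/seteqP; split=> -[x y] /= [Fx Gy].
  - by split=> //; move: Gy; congr (G i _); exact: val_inj.
  - by split=> //; move: Gy; congr (G i _); exact: val_inj.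
by rewrite product_measure1E// lte_mul_pinfty// ge0_fin_numE.
Qed.

HB.instance Definition _ := Measure_isSigmaFinite.Build _ _ _ lebesgue_cons
  lebesgue_cons_sigma_finite.

End lebesgue_cons.

Fixpoint lebesgue_tuple (R : realType) (n : nat) :
    {sigma_finite_measure set (n.-tuple R) -> \bar R} :=
  match n with
  | 0%N => \d_([tuple] : 0.-tuple R)
  | n'.+1 => lebesgue_cons (lebesgue_tuple R n')
  end.

Definition Gamma (R : realType) (x : R) : R :=
  \int[@lebesgue_measure R]_(t in `]0, +oo[) (t `^ (x - 1) * expR (- t)).

Definition poch (R : realType) (c : R) (n : nat) : R :=
  \prod_(i < n) (c + i%:R).

Section dirichlet.
Context {R : realType}.

(* Density of (X_1, ..., X_d); the parameter of X_0 is [a ord0]. *)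
Definition dirichlet_density (d : nat) (a : 'I_d.+1 -> R) (x : d.-tuple R) : R :=
  let s := \sum_(i < d) tnth x i in
  if [forall i, 0 < tnth x i] && (s < 1) then
    Gamma (\sum_i a i) / (\prod_i Gamma (a i)) *
    ((1 - s) `^ (a ord0 - 1) *
     \prod_(i < d) tnth x i `^ (a (lift ord0 i) - 1))
  else 0.

(* Dirichlet law with positive parameters, i.e. the law of (X_0, ..., X_d) with
   X_0 = 1 - X_1 - ... - X_d. For a single parameter (d = 0) the formula gives
   the Dirac mass at 1. An empty list of parameters yields the zero measure. *)
Definition dirichlet_pos (n : nat) : ('I_n -> R) -> set (n.-tuple R) -> \bar R :=
  match n return ('I_n -> R) -> set (n.-tuple R) -> \bar R with
  | 0%N => fun _ => mzero
  | d.+1 => fun a =>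
      pushforward
        (fun A : set (d.-tuple R) =>
           \int[lebesgue_tuple R d]_(x in A) (dirichlet_density a x)%:E)%E
        (fun x => [tuple of (1 - \sum_(i < d) tnth x i) :: x])
  end.

(* Dirichlet law with nonnegative parameters, not all zero: with T the set of
   indices of positive parameters, the image of the Dirichlet law of parameters
   (b_i)_(i in T) under y |-> \sum_(i in T) y_i e_i. *)
Definition dirichlet (n : nat) (b : 'I_n -> R) : set (n.-tuple R) -> \bar R :=
  let T := [pred i | 0 < b i] in
  pushforward (dirichlet_pos (fun j : 'I_#|T| => b (enum_val j)))
    (fun y : #|T|.-tuple R =>
       [tuple \sum_(j < #|T| | enum_val j == i) tnth y j | i < n]).

Definition quasi_bernoulli (d k : nat) (a : 'I_d.+1 -> R) :
    set (d.+1.-tuple R) -> \bar R := fun C =>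
  ((k`!%:R / poch (\sum_i a i) k)%:E *
   \sum_(b : {ffun 'I_d.+1 -> 'I_k.+1} | (\sum_i b i == k)%N)
     (\prod_i (poch (a i) (b i) / (b i)`!%:R))%:E *
     dirichlet (fun i => (b i)%:R) C)%E.

End dirichlet.

(* Coordinates are numbered from 0: [tnth m j] stands for m_(j+1). *)
Definition weight (k : nat) (m : k.-tuple nat) : nat :=
  (\sum_(j < k) j.+1 * tnth m j)%N.

Definition ewens_pmf (R : realType) (k : nat) (a : R) (m : k.-tuple nat) : R :=
  k`!%:R / (\prod_(j < k) (j.+1 ^ tnth m j * (tnth m j)`!))%N%:R *
  (a ^+ (\sum_(j < k) tnth m j)%N / poch a k).

Definition nblocks (k : nat) (m : k.-tuple nat) : nat :=
  (\sum_(j < k) tnth m j)%N.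

(* B(m): [reshape_index m t] is the j such that
   m_1 + ... + m_j <= t < m_1 + ... + m_(j+1), and b_(t+1) is then j + 1. *)
Definition block_sizes (k : nat) (m : k.-tuple nat) (t : 'I_(nblocks m)) : nat :=
  (reshape_index m t).+1.

Section laws.
Context {d : measure_display} {T : measurableType d} {R : realType}.
Implicit Type Q : set T -> \bar R.

Definition has_law Q d' (T' : measurableType d') (U : T -> T')
    (mu : set T' -> \bar R) : Prop :=
  measurable_fun setT U /\
  forall A, measurable A -> pushforward Q U A = mu A.

Definition cond_prob (P : probability T R) (E : set T) : set T -> \bar R :=
  fun A => (P (A `&` E) / P E)%E.

Definition mutually_independent Q d' (T' : measurableType d') (n : nat)
    (U : 'I_n -> T -> T') : Prop :=
  forall A : 'I_n -> set T', (forall t, measurable (A t)) ->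
    Q (\bigcap_(t in setT) (U t @^-1` A t)) = (\prod_(t < n) Q (U t @^-1` A t))%E.

Definition iid Q d' (T' : measurableType d') (n : nat) (U : 'I_n -> T -> T')
    (mu : set T' -> \bar R) : Prop :=
  (forall t, has_law Q (U t) mu) /\ mutually_independent Q U.

Definition independent Q d1 d2 (T1 : measurableType d1) (T2 : measurableType d2)
    (U : T -> T1) (V : T -> T2) : Prop :=
  forall A B, measurable A -> measurable B ->
    Q (U @^-1` A `&` V @^-1` B) = (Q (U @^-1` A) * Q (V @^-1` B))%E.

End laws.

Definition first_terms (T T' : Type) (n : nat) (U : nat -> T -> T') (w : T) :
  n.-tuple T' := [tuple U t w | t < n].

Definition weighted_dirac (d : measure_display) (Omega : measurableType d)
    (R : realType) (n : nat) (W : n.-tuple R) (X : n.-tuple Omega) :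
    set Omega -> \bar R :=
  fun A => (\sum_(t < n) (tnth W t)%:E * \d_(tnth X t) A)%E.

(* Main.v *)
Require Import Defs.
From mathcomp Require Import all_boot all_order all_algebra.
From mathcomp Require Import all_classical all_reals all_analysis.
From mathcomp Require Import measurable_realfun ring zify.

(* Let gamma_p be the measure of density x^(p-1) / (p-1)! on (0, oo), and gamma_0
   the Dirac mass at 0: these form a convolution semigroup, so that adding up
   coordinates along a map c : [n] -> [d] sends the product of the gamma_(b_t) to
   the product of the gamma_(b'_i), b'_i being the sum of b_t over c t = i. For
   integer parameters of sum k > 0, possibly zero, D(b)(C) is k! times the mass
   that the product of the gamma_(b_i) gives to the cone { y : 0 < s < 1, y / s
   in C }, with s the sum of y. Hence D(b) is also stable under aggregation of
   coordinates.
   Given M = m, allot the atoms X_t to the cells of the partition according to c: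
   (P(A_0), ..., P(A_d)) has the law of W aggregated along c, that is D(b) with
   b_i the total size of the blocks in cell i. Summing over m and c, the weight of
   D(b) is the coefficient of x^b z^k in exp (sum_j p_j z^j / j), where
   p_j = sum_i alpha(A_i) x_i^j. This series is prod_i (1 - x_i z)^(-alpha(A_i)),
   whose coefficients are those of the quasi Bernoulli distribution. *)

Set Implicit Arguments.
Unset Strict Implicit.
Unset Printing Implicit Defensive.

Import Order.TTheory GRing.Theory Num.Theory.
Import numFieldNormedType.Exports.

Local Open Scope classical_set_scope.
Local Open Scope ring_scope.

(** * The Ewens sum *)

Section log_derivative.
Context {R : realType} {A : comAlgType R}.
Implicit Types (F G P Q : {poly A}).

(* [F] has logarithmic derivative [Q / 'X] modulo ['X^N]. *)
Definition log_deriv (N : nat) Q F :=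
  forall i, (i < N)%N -> ('X * F^`())`_i = (Q * F)`_i.

Lemma coefM_eq_low N (P F G : {poly A}) :
  (forall i, (i < N)%N -> F`_i = G`_i) ->
  forall i, (i < N)%N -> (P * F)`_i = (P * G)`_i.
Proof.
move=> FG i iN; rewrite !coefM; apply: eq_bigr => j _.
by rewrite FG// (leq_ltn_trans _ iN)// leq_subr.
Qed.

(** Leibniz rule. It survives truncation because the coefficients of a product below [N] involve
    only coefficients of the factors below [N]. *)
Lemma log_derivM N P Q F G :
  log_deriv N P F -> log_deriv N Q G -> log_deriv N (P + Q) (F * G).
Proof.
move=> hF hG i iN; rewrite derivM mulrDr mulrDl.
rewrite (_ : 'X * (F^`() * G) = G * ('X * F^`())); last by ring.
rewrite (_ : 'X * (F * _) = F * ('X * G^`())); last by ring.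
rewrite !coefD (coefM_eq_low _ hF)// (coefM_eq_low _ hG)// -!coefD.
by apply: (congr1 (fun p : {poly A} => p`_i)); ring.
Qed.

Lemma log_deriv_prod N (I : finType) (Q F : I -> {poly A}) :
  (forall i, log_deriv N (Q i) (F i)) ->
  log_deriv N (\sum_i Q i) (\prod_i F i).
Proof.
move=> h; elim/big_rec2: _ => [i _|i P G _ hG].
  by rewrite derivC mulr0 mul0r.
exact: log_derivM.
Qed.

Lemma scaler_natrI (n : nat) : injective (fun x : A => x *+ n.+1).
Proof.
have nK (z : A) : n.+1%:R^-1 *: (n.+1%:R *: z) = z :> A.
  by rewrite scalerA mulVf ?scale1r ?pnatr_eq0.
by move=> x y /= xy; rewrite -(nK x) -(nK y) !scaler_nat xy.
Qed.

(** As [Q] has no constant term, the equation in degree i expresses i times the coefficient of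
    degree i through the lower ones, and the factor i > 0 is cancelled by [scaler_natrI]. *)
Lemma log_deriv_uniq N Q F G : Q`_0 = 0 -> F`_0 = G`_0 ->
  log_deriv N Q F -> log_deriv N Q G -> forall i, (i < N)%N -> F`_i = G`_i.
Proof.
move=> Q0 FG0 hF hG; elim/ltn_ind => -[//|i] IH iN.
have := hF _ iN; have := hG _ iN; rewrite !coefXM /= !coef_deriv => eG eF.
apply: (@scaler_natrI i); rewrite /= eF eG !coefM [LHS]big_ord_recl [RHS]big_ord_recl Q0 !mul0r.
congr (_ + _). apply: eq_bigr => j _; congr (_ * _); by apply: IH; rewrite /= /bump; lia.
Qed.

(** Truncation of exp (p z^w / w). *)
Definition exp_series (N w : nat) (p : A) : {poly A} :=
  \sum_(n < N) ((w ^ n * n`!)%:R^-1 *: p ^+ n) *: 'X^(w * n).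

Lemma exp_series_log_deriv N w p : (0 < w)%N ->
  log_deriv N (p *: 'X^w) (exp_series N w p).
Proof.
move=> w0 i iN; rewrite /exp_series linear_sum mulr_sumr mulr_sumr !coef_sum.
have -> : \sum_(n < N) ('X * (((w ^ n * n`!)%:R^-1 *: p ^+ n) *: 'X^(w * n))^`())`_i
   = \sum_(n < N) (i == w * n)%N%:R * (((w ^ n * n`!)%:R^-1 *: p ^+ n) *+ (w * n)).
  apply: eq_bigr => n _; rewrite linearZ /= derivXn.
  rewrite -scalerAr coefZ mulrnAr -exprS coefMn coefXn.
  case: (posnP (w * n)) => [->|wn0]; first by rewrite !mulr0n !mulr0.
  by rewrite prednK// !mulrnAr mulr1 mulr_natl.
rewrite [RHS](_ : _ = \sum_(n < N) (i == w * n.+1)%N%:R * ((w ^ n * n`!)%:R^-1 *: p ^+ n.+1)); last first.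
  apply: eq_bigr => n _.
  rewrite -scalerAl -scalerAr scalerA -exprD coefZ coefXn -mulnS.
  by rewrite mulrC -scalerAr -exprS.
case: N iN => [//|N iN].
rewrite big_ord_recl /= muln0 mulr0n mulr0 add0r.
rewrite [RHS]big_ord_recr /=.
(* Differentiation shifts the series by one index; the one term left over has degree [w * N.+1],
   beyond [i] since [w > 0]. *)
have -> : (i == w * N.+1)%N = false by apply/eqP; nia.
rewrite mul0r addr0; apply: eq_bigr => n _; rewrite /bump leq0n add1n.
congr (_ * _); rewrite -scaler_nat scalerA; congr (_ *: _).
have w0' : w%:R != 0 :> R by rewrite pnatr_eq0 -lt0n.
have f0 : n`!%:R != 0 :> R by rewrite pnatr_eq0 -lt0n fact_gt0.
have wn0 : w%:R ^+ n != 0 :> R by rewrite expf_neq0.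
rewrite expnS factS !natrM !natrX; field.
by rewrite f0 wn0 w0' -(natrD _ 1 n) pnatr_eq0.
Qed.

(** Truncation of (1 - x z)^(-a). *)
Definition binom_series (N : nat) (a : R) (x : A) : {poly A} :=
  \sum_(n < N) ((poch a n / n`!%:R) *: x ^+ n) *: 'X^n.

(** The coefficient of z^n in the equation z G' = (a z / (1 - z)) G satisfied by G = (1 -
    z)^(-a). *)
Lemma poch_sum (a : R) n :
  poch a n / n`!%:R *+ n = \sum_(l < n) a * (poch a l / l`!%:R).
Proof.
elim: n => [|n IH]; first by rewrite mulr0n big_ord0.
rewrite big_ord_recr /= -IH /poch big_ord_recr /= factS natrM.
have f0 : n`!%:R != 0 :> R by rewrite pnatr_eq0 -lt0n fact_gt0.
rewrite -[_ *+ n.+1]mulr_natr -[_ *+ n]mulr_natr; field.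
by rewrite f0 -(natrD _ 1 n) pnatr_eq0.
Qed.

(** The sum is the geometric expansion of a x z / (1 - x z), cut after degree [N.-1]; comparing
    coefficients leaves [poch_sum]. *)
Lemma binom_series_log_deriv N (a : R) (x : A) :
  log_deriv N (\sum_(j < N.-1) (a *: x ^+ j.+1) *: 'X^(j.+1)) (binom_series N a x).
Proof.
move=> i iN.
have cB j : (j < N)%N -> (binom_series N a x)`_j = (poch a j / j`!%:R) *: x ^+ j.
  move=> jN; rewrite coef_sum (bigD1 (Ordinal jN)) //= coefZ coefXn eqxx mulr1.
  rewrite big1 ?addr0// => l /eqP ne; rewrite coefZ coefXn.
  by case: eqP => [e|]; rewrite ?mulr0//; case: ne; apply: val_inj.
have cQ j : (j.+1 < N)%N ->
    (\sum_(j < N.-1) (a *: x ^+ j.+1) *: 'X^(j.+1) : {poly A})`_j.+1 = a *: x ^+ j.+1.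
  move=> jN; have jN' : (j < N.-1)%N by lia.
  rewrite coef_sum (bigD1 (Ordinal jN')) //= coefZ coefXn eqxx mulr1.
  rewrite big1 ?addr0// => l /eqP ne; rewrite coefZ coefXn.
  by case: eqP => [[e]|]; rewrite ?mulr0//; case: ne; apply: val_inj.
have cQ0 : (\sum_(j < N.-1) (a *: x ^+ j.+1) *: 'X^(j.+1) : {poly A})`_0 = 0.
  by rewrite coef_sum big1// => l _; rewrite coefZ coefXn mulr0.
rewrite mulrC coefMX; case: i iN => [|i] iN /=.
  by rewrite coefM big_ord_recl big_ord0 /= cQ0 mul0r addr0.
rewrite coef_deriv cB// coefMr -scaler_nat scalerA mulr_natl poch_sum scaler_suml.
rewrite [RHS]big_ord_recr /= subnn cQ0 mul0r addr0; apply: eq_bigr => l _.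
rewrite subSn -1?ltnS // cQ; last by have := ltn_ord l; lia.
have li := ltn_ord l; rewrite cB; last lia.
rewrite -[RHS]scalerAl -[X in _ = _ *: X]scalerAr -exprD scalerA; congr (_ *: _ ^+ _).
lia.
Qed.

Lemma prod_monom (I : finType) (u : I -> A) (e : I -> nat) :
  \prod_i (u i *: 'X^(e i)) = (\prod_i u i) *: 'X^(\sum_i e i) :> {poly A}.
Proof.
elim/big_rec3: _ => [|i x y z _ ->]; first by rewrite scale1r.
by rewrite exprD -scalerAl -scalerAr scalerA.
Qed.

(** Serves twice: with weights [j.+1] for the exponential factors and with weights 1 for the
    binomial ones. *)
Lemma coef_prod_series (I : finType) (N K : nat) (u : I -> nat -> A) (w : I -> nat) :
  (\prod_i \sum_(n < N) u i n *: 'X^(w i * n)%N)`_K =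
  \sum_(m : {ffun I -> 'I_N} | (\sum_i w i * m i == K)%N) \prod_i u i (m i).
Proof.
rewrite bigA_distr_bigA /= coef_sum [RHS]big_mkcond /=; apply: eq_bigr => m _.
by rewrite prod_monom coefZ coefXn eq_sym; case: ifP; rewrite ?mulr1 ?mulr0.
Qed.

(* Both sides are the coefficient of [z ^ k] in
   [exp (\sum_j p_j z ^ j / j) = \prod_i (1 - x_i z) ^ (- a_i)],
   where [p_j = \sum_i a_i x_i ^ j]. *)
Lemma cycle_index_poch (I : finType) (k : nat) (a : I -> R) (x : I -> A) :
  \sum_(m : {ffun 'I_k -> 'I_k.+1} | (\sum_(j < k) j.+1 * m j == k)%N)
     \prod_(j < k) ((j.+1 ^ m j * (m j)`!)%:R^-1 *: (\sum_i a i *: x i ^+ j.+1) ^+ m j) =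
  \sum_(b : {ffun I -> 'I_k.+1} | (\sum_i b i == k)%N)
     \prod_i ((poch (a i) (b i) / (b i)`!%:R) *: x i ^+ b i).
Proof.
pose p j := \sum_i a i *: x i ^+ j.
have E := @coef_prod_series 'I_k k.+1 k
  (fun j n => (j.+1 ^ n * n`!)%:R^-1 *: p j.+1 ^+ n) (fun j => j.+1).
have B := @coef_prod_series I k.+1 k
  (fun i n => (poch (a i) n / n`!%:R) *: x i ^+ n) (fun i => 1%N).
rewrite -{}E; under [RHS]eq_bigl do under eq_bigr do rewrite -[nat_of_ord _]mul1n.
rewrite -{}B.
set F := \prod_j _; set G := \prod_j _.
have hF : log_deriv k.+1 (\sum_(j < k) p j.+1 *: 'X^(j.+1)) F.
  by apply: log_deriv_prod => j; apply: exp_series_log_deriv.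
have hG : log_deriv k.+1 (\sum_(j < k) p j.+1 *: 'X^(j.+1)) G.
  (* Exchanging the sums over i and j writes the power sums as the total of the geometric series
     attached to the factors (1 - x_i z)^(-a_i). *)
  have -> : \sum_(j < k) p j.+1 *: 'X^(j.+1) =
      \sum_i \sum_(j < k) (a i *: x i ^+ j.+1) *: 'X^(j.+1) :> {poly A}.
    by rewrite exchange_big /=; apply: eq_bigr => j _; rewrite scaler_suml.
  apply: log_deriv_prod => i; set g := (X in log_deriv _ _ X).
  have -> : g = binom_series k.+1 (a i) (x i).
    by apply: eq_bigr => n _; rewrite mul1n.
  exact: binom_series_log_deriv.
apply: (log_deriv_uniq _ _ hF hG) => //.
  by rewrite coef_sum big1// => j _; rewrite coefZ coefXn mulr0.
(* Both constant terms are 1: at 0 only the summand of index 0 in each factor survives. *)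
rewrite /F /G -!horner_coef0 !horner_prod !big1// => i _; rewrite horner_sum big_ord_recl big1.
- by rewrite !hornerZ !hornerXn expr0 /poch big_ord0 fact0 divr1 !scale1r mulr1 addr0.
- by move=> n _; rewrite hornerZ hornerXn expr0n /= mulr0.
- by rewrite !hornerZ !hornerXn expr0 /poch ?mul1n fact0 invr1 muln0 !scale1r mulr1 addr0.
- by move=> n _; rewrite hornerZ hornerXn expr0n /= mulr0.
Qed.

End log_derivative.

(** * Block sizes and allocations of blocks to cells *)

Lemma digits_inj (n N : nat) (b c : 'I_n -> nat) :
  (forall i, b i < N)%N -> (forall i, c i < N)%N ->
  (\sum_i b i * N ^ i = \sum_i c i * N ^ i)%N -> b =1 c.
Proof.
elim: n b c => [b c _ _ _ [//]|n IH b c bN cN].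
rewrite !big_ord_recl !expn0 !muln1.
under eq_bigr do rewrite lift0 expnSr mulnA.
under [X in _ = (_ + X)%N -> _]eq_bigr do rewrite lift0 expnSr mulnA.
rewrite -!big_distrl /= => e.
have e0 : b ord0 = c ord0.
  by move/(congr1 (modn^~ N)) : e; rewrite ![(_ + _ * N)%N]addnC !modnMDl !modn_small.
have N0 : (0 < N)%N by exact: leq_ltn_trans (bN ord0).
have es : forall i, b (lift ord0 i) = c (lift ord0 i).
  apply: IH => //; move/eqP: e.
  by rewrite e0 eqn_add2l eqn_pmul2r// => /eqP.
by move=> i; case: (unliftP ord0 i) => [j ->|->].
Qed.

Lemma nblocks_sumn (k : nat) (m : k.-tuple nat) : nblocks m = sumn m.
Proof. by rewrite sumnE big_tuple. Qed.

Section blocks.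
Variables (A : Type) (idx : A) (op : Monoid.com_law idx).

(** [reshape_index sh] takes the value j on a run of [nth 0 sh j] consecutive arguments; the
    induction splits off the first run. A general commutative monoid covers both the products and
    the sums over blocks. *)
Lemma big_reshape_index (sh : seq nat) (F : nat -> A) :
  \big[op/idx]_(0 <= t < sumn sh) F (reshape_index sh t) =
  \big[op/idx]_(0 <= j < size sh) iterop (nth 0 sh j)%N op (F j) idx.
Proof.
elim: sh F => [|n sh IH] F; first by rewrite !big_nil.
rewrite [size _]/= [sumn _]/= big_nat_recl// (@big_cat_nat _ _ _ n) ?leq_addr//=.
apply: (f_equal2 op).
  rewrite Monoid.iteropE -[X in iter X]subn0 -big_const_nat; apply: eq_big_nat => t /andP[_ tn].
  by rewrite /reshape_index /= subn_eq0 tn.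
rewrite -{1}[n]add0n big_addn addKn -IH; apply: eq_bigr => t _.
by rewrite /reshape_index /= subn_eq0 ltnNge leq_addl /= -addSn addnK.
Qed.

End blocks.

Lemma prod_block_sizes (A : comNzRingType) (k : nat) (m : k.-tuple nat) (F : nat -> A) :
  \prod_(t < nblocks m) F (block_sizes t) = \prod_(j < k) F j.+1 ^+ tnth m j.
Proof.
transitivity (\prod_(0 <= t < nblocks m) F (reshape_index m t).+1).
  by rewrite big_mkord.
rewrite nblocks_sumn (big_reshape_index _ m (fun j => F j.+1)) size_tuple big_mkord.
by apply: eq_bigr => j _; rewrite (tnth_nth 0%N).
Qed.

Lemma sum_block_sizes (k : nat) (m : k.-tuple nat) :
  (\sum_(t < nblocks m) block_sizes t = weight m)%N.
Proof.
transitivity (\sum_(0 <= t < nblocks m) (reshape_index m t).+1)%N.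
  by rewrite big_mkord.
rewrite nblocks_sumn (big_reshape_index _ m succn) size_tuple big_mkord.
apply: eq_bigr => j _; rewrite (tnth_nth 0%N) Monoid.iteropE iter_addn addn0.
by rewrite mulnC.
Qed.

Definition block_count (n d : nat) (s : 'I_n -> nat) (c : 'I_n -> 'I_d) (i : 'I_d) : nat :=
  (\sum_(t | c t == i) s t)%N.

Lemma sum_block_count n d (s : 'I_n -> nat) (c : 'I_n -> 'I_d) :
  (\sum_i block_count s c i = \sum_t s t)%N.
Proof. by rewrite /block_count (partition_big c predT). Qed.

(** A tuple of weight [k] has entries at most [k], so finite functions with bounded values reduce
    the sum over such tuples to one over a finite type. *)
Definition tuple_of_ffun k N (m : {ffun 'I_k -> 'I_N}) : k.-tuple nat :=
  [tuple (m j : nat) | j < k].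

(* Monomials [x ^ b] with all [b i <= k] are encoded in one variable by the
   Kronecker substitution [x_i = 'X^(k.+1 ^ i)]. *)
Lemma ewens_assignments (R : realType) (d k : nat) (a : 'I_d -> R)
    (Phi : ('I_d -> nat) -> R) :
  \sum_(m : {ffun 'I_k -> 'I_k.+1} | weight (tuple_of_ffun m) == k)
     (\prod_(j < k) (j.+1 ^ m j * (m j)`!)%N%:R)^-1 *
     \sum_(c : {ffun 'I_(nblocks (tuple_of_ffun m)) -> 'I_d})
        (\prod_t a (c t)) * Phi (block_count (@block_sizes _ _) c) =
  \sum_(b : {ffun 'I_d -> 'I_k.+1} | (\sum_i b i == k)%N)
     (\prod_i (poch (a i) (b i) / (b i)`!%:R)) * Phi (fun i => b i).
Proof.
pose code (b : 'I_d -> nat) := (\sum_i b i * k.+1 ^ i)%N.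
pose x (i : 'I_d) : {poly R} := 'X^(k.+1 ^ i).
(* The linear form that reads the coefficient of each encoded monomial x^b and replaces the monomial
   by [Phi b]. *)
pose L (p : {poly R}) := \sum_(b : {ffun 'I_d -> 'I_k.+1}) p`_(code (fun i => b i)) * Phi (fun i => b i).
have Lsum (I : finType) (P : pred I) (c : I -> R) (p : I -> {poly R}) :
    L (\sum_(i | P i) c i *: p i) = \sum_(i | P i) c i * L (p i).
  rewrite /L; under [RHS]eq_bigr do rewrite mulr_sumr.
  rewrite [RHS]exchange_big; apply: eq_bigr => b _; rewrite coef_sum mulr_suml.
  by apply: eq_bigr => i _; rewrite coefZ mulrA.
have LX (e : 'I_d -> nat) : (forall i, e i <= k)%N -> L 'X^(code e) = Phi e.
  move=> ek; pose e' : {ffun 'I_d -> 'I_k.+1} := [ffun i => inord (e i)].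
  have ee' : (fun i => e' i : nat) = e.
    by apply/funext => i; rewrite ffunE inordK// ltnS.
  rewrite /L (bigD1 e')//= ee' coefXn eqxx mul1r big1 ?addr0// => b be.
  (* Equal codes force equal exponents, as these are digits in base [k.+1]. *)
  rewrite coefXn; case: eqP; rewrite ?mul0r// => /digits_inj E.
  case/eqP: be; apply/ffunP => i; apply: val_inj => /=; rewrite E//.
    by rewrite -[RHS]/((fun i => e' i : nat) i) ee'.
have xX (I : finType) (s : I -> nat) (c : I -> 'I_d) :
    \prod_t x (c t) ^+ s t = 'X^(code (fun i => \sum_(t | c t == i) s t)%N).
  rewrite /x; under eq_bigr do rewrite -exprM.
  rewrite -expr_sum; congr ('X^_); rewrite (partition_big c predT)//=.
  apply: eq_bigr => i _; rewrite big_distrl /=; apply: eq_bigr => t /eqP ->.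
  by rewrite mulnC.
have := congr1 L (cycle_index_poch k a x).
under eq_bigr do rewrite scaler_prod.
rewrite Lsum; under [X in _ = L X]eq_bigr do rewrite scaler_prod.
rewrite Lsum => E; transitivity (\sum_(m : {ffun 'I_k -> 'I_k.+1} | (\sum_(j < k) j.+1 * m j == k)%N)
   (\prod_(j < k) ((j.+1 ^ m j * (m j)`!)%:R^-1 : R)) *
   L (\prod_(j < k) (\sum_i a i *: x i ^+ j.+1) ^+ m j)); last first.
  rewrite E; apply: eq_bigr => b _; congr (_ * _).
  rewrite -[X in L X]/(\prod_i x (id i) ^+ (b i)) xX LX; last first.
    by move=> i; rewrite big_pred1_eq -ltnS.
  by congr Phi; apply/funext => i; rewrite big_pred1_eq.
have wE (m : {ffun 'I_k -> 'I_k.+1}) : weight (tuple_of_ffun m) = (\sum_(j < k) j.+1 * m j)%N.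
  by apply: eq_bigr => j _; rewrite tnth_mktuple.
under eq_bigl do rewrite wE.
apply: eq_bigr => m /eqP mk; rewrite prodfV; congr (_ * _).
(* With one factor per block, expanding the product amounts to choosing a cell [c t] for every block
   t. *)
have -> : \prod_(j < k) (\sum_i a i *: x i ^+ j.+1) ^+ m j =
   \prod_(t < nblocks (tuple_of_ffun m)) \sum_i a i *: x i ^+ (block_sizes t).
  rewrite (prod_block_sizes (tuple_of_ffun m) (fun b => \sum_i a i *: x i ^+ b)).
  by apply: eq_bigr => j _; rewrite tnth_mktuple.
rewrite bigA_distr_bigA /=; under [X in _ = L X]eq_bigr do rewrite scaler_prod.
rewrite Lsum; apply: eq_bigr => c _; rewrite xX LX// => i.
(* Every exponent is bounded by the total block size [k], so that [L] decodes the monomial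
   correctly. *)
apply: leq_trans (_ : \sum_i block_count (@block_sizes _ (tuple_of_ffun m)) c i <= _)%N.
  by rewrite (bigD1 i)//= leq_addr.
by rewrite sum_block_count sum_block_sizes wE mk.
Qed.

(** * Iterated gamma integrals *)

Section gamma_integral.
Context {R : realType}.
Local Notation mu := (@lebesgue_measure R).
Local Open Scope ereal_scope.

(** The gamma density of shape [q.+1] stripped of its exponential factor, which makes it homogeneous
    under scaling. *)
Definition gamma_den (q : nat) (x : R) : R :=
  (\1_(`]0, +oo[%classic : set R) x * (x ^+ q / q`!%:R))%R.

Lemma gamma_den_ge0 q x : (0 <= gamma_den q x)%R.
Proof.
rewrite /gamma_den indicE; case: (boolP (x \in _)) => [|_]; last by rewrite mul0r.
rewrite inE /= in_itv /= andbT => x0.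
by rewrite mul1r divr_ge0// exprn_ge0// ltW.
Qed.

Lemma gamma_den_gt0E q x : (0 < x)%R -> gamma_den q x = (x ^+ q / q`!%:R)%R.
Proof. by move=> x0; rewrite /gamma_den indicE mem_set ?mul1r//= in_itv/= x0. Qed.

Lemma gamma_den_le0E q x : (x <= 0)%R -> gamma_den q x = 0%R.
Proof.
by move=> x0; rewrite /gamma_den indicE memNset ?mul0r//= in_itv/= andbT ltNge x0.
Qed.

Lemma measurable_gamma_den q : measurable_fun setT (gamma_den q).
Proof.
apply: measurable_funM; first exact: measurable_indic.
by apply: measurable_funM => //; exact: exprn_measurable.
Qed.

Lemma measurable_gamma_denE q : measurable_fun setT (fun x : R => (gamma_den q x)%:E).
Proof. by apply/measurable_EFinP; exact: measurable_gamma_den. Qed.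

(* Integral against the law of density [x ^ (p - 1) / (p - 1)!] on the positive
   half-line, degenerating to the Dirac mass at 0 for [p = 0]: a convolution
   semigroup in [p]. *)
Definition gamma_int (p : nat) (f : R -> \bar R) : \bar R :=
  if p is q.+1 then \int[mu]_x (f x * (gamma_den q x)%:E) else f 0%R.

Lemma gamma_int_ge0 p f : (forall x, 0 <= f x) -> 0 <= gamma_int p f.
Proof.
case: p => [|p] f0 /=; first exact: f0.
by apply: integral_ge0 => x _; rewrite mule_ge0// lee_fin gamma_den_ge0.
Qed.

Lemma gamma_intZ p (k : R) f : (0 <= k)%R -> measurable_fun setT f ->
  (forall x, 0 <= f x) ->
  gamma_int p (fun x => k%:E * f x) = k%:E * gamma_int p f.
Proof.
move=> k0 mf f0; case: p => [//|p] /=; under eq_integral do rewrite -muleA.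
rewrite ge0_integralZl_EFin//.
- by move=> x _; rewrite mule_ge0// lee_fin gamma_den_ge0.
- by apply: emeasurable_funM => //; exact: measurable_gamma_denE.
Qed.

Lemma measurable_gamma_int d (T : measurableType d) p (f : T * R -> \bar R) :
  measurable_fun setT f -> (forall x, 0 <= f x) ->
  measurable_fun setT (fun t => gamma_int p (fun x => f (t, x))).
Proof.
move=> mf f0; case: p => [|p] /=; first exact: measurable_fun_pair1.
apply: (measurable_fun_fubini_tonelli_F
  (fun z : T * measurableTypeR R => f z * (gamma_den p z.2)%:E)).
  apply: emeasurable_funM => //.
  by apply: (measurableT_comp (measurable_gamma_denE p)); exact: measurable_snd.
by move=> z; rewrite mule_ge0// lee_fin gamma_den_ge0.
Qed.

Lemma gamma_int_tonelli d (T : measurableType d)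
    (nu : {sigma_finite_measure set T -> \bar R}) p (f : T * R -> \bar R) :
  measurable_fun setT f -> (forall x, 0 <= f x) ->
  \int[nu]_t gamma_int p (fun x => f (t, x)) =
  gamma_int p (fun x => \int[nu]_t f (t, x)).
Proof.
move=> mf f0; case: p => [//|p] /=.
rewrite (fubini_tonelli (m1 := nu) (m2 := mu)
  (fun z : T * measurableTypeR R => f z * (gamma_den p z.2)%:E))/=.
- apply: eq_integral => x _; rewrite ge0_integralZr// ?lee_fin ?gamma_den_ge0//.
  exact: measurable_fun_pair1.
- apply: emeasurable_funM => //.
  by apply: (measurableT_comp (measurable_gamma_denE p)); exact: measurable_snd.
- by move=> z; rewrite mule_ge0// lee_fin gamma_den_ge0.
Qed.


Lemma measurable_affine (s c : R) :
  measurable_fun [set: measurableTypeR R] (fun x : R => (s * x + c)%R : measurableTypeR R).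
Proof. by apply: measurable_funD => //; exact: mulrl_measurable. Qed.

(** By uniqueness of Lebesgue measure it is enough to compare the two sides on half-open
    intervals. *)
Lemma lebesgue_measure_affine (s : {posnum R}) (c : R) (A : set R) : measurable A ->
  pushforward (mscale (NngNum (ltW [gt0 of s%:num])) mu)
    (fun x : R => (s%:num * x + c)%R : measurableTypeR R) A = mu A.
Proof.
move=> mA; have mf := measurable_affine s%:num c.
apply/esym/lebesgue_measure_unique => //= _ [[a b]] _ <-.
rewrite /pushforward /mscale /= (_ : _ @^-1` _ =
   `](a - c) / s%:num, (b - c) / s%:num]%classic)%R; last first.
  apply/seteqP; split => x /=; rewrite !in_itv /= ltr_pdivrMr// ler_pdivlMr//;
    by rewrite [(_ * x)%R]mulrC ltrBlDr lerBrDr.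
rewrite !lebesgue_measure_itv /= !lte_fin ltr_pM2r// ltrD2r.
case: ifP => _; last by rewrite mule0.
rewrite -!EFinD -EFinM; congr EFin; field.
exact: lt0r_neq0.
Qed.

Lemma ge0_integral_affine (s c : R) (f : R -> \bar R) : (0 < s)%R ->
  measurable_fun setT f -> (forall x, 0 <= f x) ->
  \int[mu]_x f x = s%:E * \int[mu]_x f (s * x + c)%R.
Proof.
move=> s0 mf f0; pose s' := PosNum s0.
have ms := measurable_affine s c.
rewrite -[X in X%:E]/((NngNum (ltW [gt0 of s'%:num]))%:num).
rewrite -ge0_integral_mscale//; last exact: measurableT_comp.
set m := mscale _ _.
transitivity (\int[m]_(x in (fun x => s * x + c)%R @^-1` setT)
   (f \o (fun x => s * x + c)%R) x); last by rewrite preimage_setT.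
rewrite -(ge0_integral_pushforward ms)//.
by apply: eq_measure_integral => A mA _; exact/esym/(lebesgue_measure_affine s' c).
Qed.

(** Homogeneity of degree [p]: the density gives s^(p - 1) and the change of variable one more s,
    while for p = 0 the mass at 0 is invariant. *)
Lemma gamma_intM p (s : R) f : (0 < s)%R -> measurable_fun setT f ->
  (forall x, 0 <= f x) ->
  gamma_int p f = (s ^+ p)%:E * gamma_int p (fun x => f (s * x)%R).
Proof.
move=> s0 mf f0; case: p => [|p] /=; first by rewrite mulr0 mul1e.
have mfd : measurable_fun setT (fun x => f x * (gamma_den p x)%:E).
  by apply: emeasurable_funM => //; exact: measurable_gamma_denE.
rewrite (@ge0_integral_affine s 0)//; last first.
  by move=> x; rewrite mule_ge0// lee_fin gamma_den_ge0.
under eq_integral do rewrite addr0.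
rewrite exprS EFinM -muleA; congr (_ * _).
rewrite -ge0_integralZl_EFin//.
- apply: eq_integral => x _; rewrite muleCA; congr (_ * _); rewrite -EFinM; congr EFin.
  have e : (\1_(`]0, +oo[%classic : set R) (s * x) = \1_(`]0, +oo[%classic : set R) x :> R)%R.
    rewrite !indicE; congr (nat_of_bool _)%:R.
    by apply/idP/idP; rewrite !inE /= !in_itv/= !andbT pmulr_rgt0.
  by rewrite /gamma_den e exprMn; ring.
- by move=> x _; rewrite mule_ge0// lee_fin gamma_den_ge0.
- apply: emeasurable_funM; last exact: measurable_gamma_denE.
  by apply: measurableT_comp => //; exact: mulrl_measurable.
- by rewrite exprn_ge0// ltW.
Qed.

(** [gamma_den 0] is the indicator of the positive half-line, so the convolution integrates y^q / q!
    from 0 to x. *)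
Lemma gamma_den_conv q x :
  \int[mu]_y ((gamma_den q y)%:E * (gamma_den 0 (x - y))%:E) = (gamma_den q.+1 x)%:E.
Proof.
have den0 y : gamma_den 0 y = (0 < y)%R%:R.
  rewrite /gamma_den expr0 fact0 divr1 mulr1 indicE; congr (_%:R : R).
  by congr nat_of_bool; apply/idP/idP; rewrite inE /= in_itv/= andbT.
have [x0|x0] := leP x 0%R.
  rewrite gamma_den_le0E// integral0_eq// => y _.
  rewrite den0 subr_gt0; have [yx|] := ltP y x; last by rewrite mule0.
  by rewrite gamma_den_le0E ?mul0e// (le_trans (ltW yx)).
transitivity (\int[mu]_(y in `]0%R, x[) (y ^+ q / q`!%:R)%:E).
  rewrite [RHS]integral_mkcond; apply: eq_integral => y _.
  rewrite /patch; case: ifPn; rewrite (inE, notin_setE) /= in_itv/=.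
    by move=> /andP[y0 yx]; rewrite gamma_den_gt0E// den0 subr_gt0 yx mule1.
  move/negP; rewrite den0 subr_gt0; have [y0 /=|y0 _] := ltP 0%R y; last by rewrite gamma_den_le0E ?mul0e.
  by move/negPf => ->; rewrite mule0.
rewrite -(@integral_itv_bndoo _ _ _ _ true false); last first.
  apply/measurable_EFinP; apply: measurable_funTS.
  by apply: measurable_funM => //; exact: exprn_measurable.
pose F (y : R) := (q.+1`!%:R^-1 * y ^+ q.+1)%R.
have fac n : (n`!%:R != 0 :> R)%R by rewrite pnatr_eq0 -lt0n fact_gt0.
have dF (y : R) : is_derive y 1%R F (y ^+ q / q`!%:R)%R.
  have dX : is_derive y 1%R (fun z : R => z ^+ q.+1)%R (q.+1%:R * y ^+ q)%R.
    apply: DeriveDef; first exact: exprn_derivable.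
    by rewrite exp_derive /= [LHS]mulr1.
  have := is_deriveZ (q.+1`!%:R^-1 : R) dX.
  rewrite /F /GRing.scale /= factS natrM => h; apply: is_derive_eq.
  by field; rewrite fac -(natrD _ 1 q) pnatr_eq0.
have cF : continuous F.
  by move=> y; apply: differentiable_continuous; apply/derivable1_diffP; have [] := dF y.
rewrite (@continuous_FTC2 _ _ F)//.
- by rewrite /F expr0n mulr0 sube0 gamma_den_gt0E// mulrC.
- apply: continuous_subspaceT => y; apply: cvgM; last exact: cvg_cst.
  exact: exprn_continuous.
- split; first by move=> y _; have [] := dF y.
  + exact/cvg_at_right_filter/cF.
  + exact/cvg_at_left_filter/cF.
- by move=> y _; rewrite derive1E; have [_ ->] := dF y.
Qed.

(** One step of the semigroup property: after Tonelli, [gamma_den_conv] identifies the density of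
    the sum; for p = 0 the inner integral is an evaluation at 0. *)
Lemma gamma_int1_conv p f : measurable_fun setT f -> (forall x, 0 <= f x) ->
  gamma_int 1 (fun x => gamma_int p (fun y => f (y + x)%R)) = gamma_int p.+1 f.
Proof.
move=> mf f0; case: p => [|q].
  by rewrite /=; under eq_integral do rewrite add0r.
have gge0 n y : 0 <= (gamma_den n y)%:E by rewrite lee_fin gamma_den_ge0.
have mg n := measurable_gamma_denE n.
rewrite /=; transitivity (\int[mu]_x \int[mu]_y
    (f (y + x)%R * (gamma_den q y)%:E * (gamma_den 0 x)%:E)).
  apply: eq_integral => x _; rewrite ge0_integralZr//.
  - apply: emeasurable_funM => //. 
      apply: (measurableT_comp mf (g := fun y : R => (y + x)%R)).
      exact: measurable_funD.
    exact: mg.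
  - by move=> y _; rewrite mule_ge0.
rewrite (fubini_tonelli (m1 := mu) (m2 := mu)
  (fun z => f (z.2 + z.1)%R * (gamma_den q z.2)%:E * (gamma_den 0 z.1)%:E))/=; last 2 first.
- apply: emeasurable_funM.
    apply: emeasurable_funM.
      apply: (measurableT_comp mf (g := fun z : R * R => (z.2 + z.1)%R)).
      by apply: measurable_funD; [exact: measurable_snd|exact: measurable_fst].
    by apply: (measurableT_comp (mg q)); exact: measurable_snd.
  by apply: (measurableT_comp (mg 0%N)); exact: measurable_fst.
- by move=> z; rewrite !mule_ge0.
transitivity (\int[mu]_y \int[mu]_x
    (f x * ((gamma_den q y)%:E * (gamma_den 0 (x - y)%R)%:E))).
  apply: eq_integral => y _.
  (* Translating by y makes the argument of [f] a variable of integration; a second exchange then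
     isolates the convolution of the two densities. *)
  rewrite (@ge0_integral_affine 1 (- y) (fun x => f (y + x)%R * _ * _))//.
  - rewrite mul1e; apply: eq_integral => x _.
    by rewrite mul1r addrCA subrr addr0 muleA.
  - apply: emeasurable_funM; last exact: mg.
    apply: emeasurable_funM; last exact: measurable_cst.
    apply: (measurableT_comp mf (g := fun x : R => (y + x)%R)).
    exact: measurable_funD.
  - by move=> x; rewrite !mule_ge0.
rewrite (fubini_tonelli (m1 := mu) (m2 := mu)
  (fun z => f z.2 * ((gamma_den q z.1)%:E * (gamma_den 0 (z.2 - z.1)%R)%:E)))/=; last 2 first.
- apply: emeasurable_funM.
    by apply: (measurableT_comp mf); exact: measurable_snd.
  apply: emeasurable_funM.
    by apply: (measurableT_comp (mg q)); exact: measurable_fst.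
  apply: (measurableT_comp (mg 0%N)).
  by apply: measurable_funB; [exact: measurable_snd|exact: measurable_fst].
- by move=> z; rewrite !mule_ge0.
apply: eq_integral => x _; rewrite -gamma_den_conv ge0_integralZl//.
- apply: emeasurable_funM; first exact: mg.
  apply: (measurableT_comp (mg 0%N) (g := fun y : R => (x - y)%R)).
  exact: measurable_funB.
- by move=> y _; rewrite mule_ge0.
Qed.

End gamma_integral.

(** * Products of gamma measures and aggregation of coordinates *)

Section gamma_tuple.
Context {R : realType}.
Local Notation mu := (@lebesgue_measure R).
Local Open Scope ereal_scope.

Lemma gamma_int_swap p q (f : R * R -> \bar R) :
  measurable_fun setT f -> (forall z, 0 <= f z) ->
  gamma_int p (fun x => gamma_int q (fun y => f (x, y))) =
  gamma_int q (fun y => gamma_int p (fun x => f (x, y))).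
Proof.
move=> mf f0; case: p => [//|p] /=.
pose g (z : R * R) := (gamma_den p z.1)%:E * f z.
have mg : measurable_fun setT g.
  apply: emeasurable_funM => //.
  by apply: (measurableT_comp (measurable_gamma_denE p)); exact: measurable_fst.
have g0 z : 0 <= g z by rewrite mule_ge0// lee_fin gamma_den_ge0.
transitivity (\int[mu]_x gamma_int q (fun y => g (x, y))).
  apply: eq_integral => x _.
  rewrite muleC; apply/esym.
  exact: (gamma_intZ q (gamma_den_ge0 p x) (measurable_fun_pair2 x mf) (fun y => f0 (x, y))).
rewrite gamma_int_tonelli//; congr (gamma_int q _); apply/funext => y.
by apply: eq_integral => x _; rewrite muleC.
Qed.

(** Integration against the product of the gamma measures, written as iterated integrals so that
    coordinates of parameter 0, which have no density, are treated like the others. *)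
Fixpoint gamma_tuple (n : nat) : ('I_n -> nat) -> (n.-tuple R -> \bar R) -> \bar R :=
  match n with
  | 0%N => fun _ f => f [tuple]
  | n'.+1 => fun b f => gamma_int (b ord0)
      (fun x => gamma_tuple (fun i => b (lift ord0 i)) (fun y => f (tcons (x, y))))
  end.

Lemma gamma_tuple_ge0 n (b : 'I_n -> nat) f : (forall y, 0 <= f y) ->
  0 <= gamma_tuple b f.
Proof.
elim: n b f => [|n IH] b f f0 /=; first exact: f0.
by apply: gamma_int_ge0 => x; apply: IH.
Qed.

Lemma measurable_comp_tcons d (T : measurableType d) n
    (f : T * n.+1.-tuple R -> \bar R) : measurable_fun setT f ->
  measurable_fun setT (fun z : (T * R) * n.-tuple R => f (z.1.1, tcons (z.1.2, z.2))).
Proof.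
move=> mf; apply: (measurableT_comp mf
  (g := fun z : (T * R) * n.-tuple R => (z.1.1, tcons (z.1.2, z.2)))).
apply: measurable_fun_pair.
  by apply: measurableT_comp; [exact: measurable_fst|exact: measurable_fst].
apply: (measurableT_comp (@measurable_tcons R n)
  (g := fun z : (T * R) * n.-tuple R => (z.1.2, z.2))).
apply: measurable_fun_pair; last exact: measurable_snd.
by apply: measurableT_comp; [exact: measurable_snd|exact: measurable_fst].
Qed.

Lemma measurable_gamma_tuple d (T : measurableType d) n (b : 'I_n -> nat)
    (f : T * n.-tuple R -> \bar R) :
  measurable_fun setT f -> (forall z, 0 <= f z) ->
  measurable_fun setT (fun t => gamma_tuple b (fun y => f (t, y))).
Proof.
elim: n d T b f => [|n IH] d T b f mf f0 /=; first exact: measurable_fun_pair1.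
apply: (measurable_gamma_int (b ord0) (f := fun z : T * R =>
   gamma_tuple (fun i => b (lift ord0 i)) (fun y => f (z.1, tcons (z.2, y))))).
  apply: (IH _ _ _ (fun z : (T * R) * n.-tuple R => f (z.1.1, tcons (z.1.2, z.2)))) => //.
  exact: measurable_comp_tcons.
by move=> z; apply: gamma_tuple_ge0.
Qed.

Lemma measurable_comp_tcons1 n (f : n.+1.-tuple R -> \bar R) :
  measurable_fun setT f ->
  measurable_fun setT (fun z : R * n.-tuple R => f (tcons z)).
Proof. by move=> mf; exact: (measurableT_comp mf (@measurable_tcons R n)). Qed.

Lemma gamma_tuple_tonelli d (T : measurableType d)
    (nu : {sigma_finite_measure set T -> \bar R}) n (b : 'I_n -> nat)
    (f : T * n.-tuple R -> \bar R) :
  measurable_fun setT f -> (forall z, 0 <= f z) ->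
  \int[nu]_t gamma_tuple b (fun y => f (t, y)) =
  gamma_tuple b (fun y => \int[nu]_t f (t, y)).
Proof.
elim: n b f => [//|n IH] b f mf f0 /=.
have mf' := measurable_comp_tcons mf.
rewrite (gamma_int_tonelli nu (b ord0) (f := fun z : T * R =>
   gamma_tuple (fun i => b (lift ord0 i)) (fun y => f (z.1, tcons (z.2, y))))).
- congr (gamma_int _ _); apply/funext => x.
  rewrite (IH _ (fun z => f (z.1, tcons (x, z.2))))//.
  apply: (measurableT_comp mf (g := fun z : T * n.-tuple R => (z.1, tcons (x, z.2)))).
  apply: measurable_fun_pair; first exact: measurable_fst.
  apply: (measurableT_comp (@measurable_tcons R n)
    (g := fun z : T * n.-tuple R => (x, z.2))).
  by apply: measurable_fun_pair; [exact: measurable_cst|exact: measurable_snd].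
- exact: (measurable_gamma_tuple _ mf').
- by move=> z; apply: gamma_tuple_ge0.
Qed.

Lemma measurable_gamma_tuple_tcons n (b : 'I_n -> nat) (f : n.+1.-tuple R -> \bar R) :
  measurable_fun setT f -> (forall y, 0 <= f y) ->
  measurable_fun setT (fun x : R => gamma_tuple b (fun y => f (tcons (x, y)))).
Proof.
by move=> mf f0; apply: (measurable_gamma_tuple b (measurable_comp_tcons1 mf)).
Qed.

Lemma gamma_tupleZ n (b : 'I_n -> nat) (k : R) f : (0 <= k)%R ->
  measurable_fun setT f -> (forall y, 0 <= f y) ->
  gamma_tuple b (fun y => k%:E * f y) = k%:E * gamma_tuple b f.
Proof.
move=> k0; elim: n b f => [//|n IH] b f mf f0 /=.
rewrite -gamma_intZ//.
- congr (gamma_int _ _); apply/funext => x; rewrite IH//.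
  exact: (measurable_fun_pair2 x (measurable_comp_tcons1 mf)).
- exact: measurable_gamma_tuple_tcons.
- by move=> x; apply: gamma_tuple_ge0.
Qed.

Definition add_coord n (y : n.-tuple R) (i : 'I_n) (x : R) : n.-tuple R :=
  [tuple if j == i then (tnth y j + x)%R else tnth y j | j < n].

Lemma add_coord_tcons0 n (z : R) (y : n.-tuple R) x :
  add_coord (tcons (z, y)) ord0 x = tcons ((z + x)%R, y).
Proof.
apply: eq_from_tnth => j; rewrite tnth_mktuple.
case: (unliftP ord0 j) => [i ->|->]; last by rewrite eqxx.
by rewrite eq_sym (negbTE (neq_lift _ _)) !tnthS.
Qed.

Lemma add_coord_tcons n (z : R) (y : n.-tuple R) i x :
  add_coord (tcons (z, y)) (lift ord0 i) x = tcons (z, add_coord y i x).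
Proof.
apply: eq_from_tnth => j; rewrite tnth_mktuple.
case: (unliftP ord0 j) => [j' ->|->]; last first.
  by rewrite (negbTE (neq_lift _ _)).
by rewrite !tnthS tnth_mktuple (inj_eq lift_inj).
Qed.

Lemma measurable_add_coord n (i : 'I_n) :
  measurable_fun setT (fun z : n.-tuple R * R => add_coord z.1 i z.2).
Proof.
have mt j : measurable_fun setT (fun z : n.-tuple R * R => tnth z.1 j).
  by apply: (measurableT_comp (measurable_tnth j)); exact: measurable_fst.
apply/measurable_fun_tnthP => j; rewrite /add_coord.
rewrite (_ : _ \o _ = fun z => if j == i then (tnth z.1 j + z.2)%R else tnth z.1 j).
  by case: eqP => _ //; apply: measurable_funD => //; exact: measurable_snd.
by apply/funext => z /=; rewrite tnth_mktuple.
Qed.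

Lemma measurable_comp_add_coord n (i : 'I_n) (f : n.-tuple R -> \bar R) :
  measurable_fun setT f ->
  measurable_fun setT (fun z : R * n.-tuple R => f (add_coord z.2 i z.1)).
Proof.
move=> mf; apply: (measurableT_comp mf (g := fun z : R * n.-tuple R => add_coord z.2 i z.1)).
apply: (measurableT_comp (measurable_add_coord i) (g := fun z : R * n.-tuple R => (z.2, z.1))).
by apply: measurable_fun_pair; [exact: measurable_snd|exact: measurable_fst].
Qed.

(** On the first coordinate this is [gamma_int1_conv]; for a later one, [gamma_int_swap] moves the
    added variable past the first coordinate and induction applies. *)
Lemma gamma_tuple_add1 n (b : 'I_n -> nat) i (f : n.-tuple R -> \bar R) :
  measurable_fun setT f -> (forall y, 0 <= f y) ->
  gamma_int 1 (fun x => gamma_tuple b (fun y => f (add_coord y i x))) =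
  gamma_tuple (fun j => b j + (j == i))%N f.
Proof.
elim: n b i f => [|n IH] b i f mf f0; first by case: i.
rewrite [RHS]/=; case: (unliftP ord0 i) => [i' ->|->]; last first.
  rewrite eqxx addn1 -[RHS]gamma_int1_conv.
  - congr (gamma_int 1 _); apply/funext => x /=; congr (gamma_int _ _).
    apply/funext => z; congr (gamma_tuple _ _); last first.
      by apply/funext => y; rewrite add_coord_tcons0.
    by apply/funext => j; rewrite addn0.
  - exact: measurable_gamma_tuple_tcons.
  - by move=> x; apply: gamma_tuple_ge0.
rewrite (negbTE (neq_lift _ _)) addn0.
under [in RHS]eq_fun do under eq_fun do rewrite (inj_eq lift_inj).
have mg : measurable_fun setT (fun w : (R * R) * n.-tuple R =>
    f (tcons (w.1.2, add_coord w.2 i' w.1.1))).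
  apply: (measurableT_comp mf (g := fun w : (R * R) * n.-tuple R =>
    tcons (w.1.2, add_coord w.2 i' w.1.1))).
  apply: (measurableT_comp (@measurable_tcons R n)
    (g := fun w : (R * R) * n.-tuple R => (w.1.2, add_coord w.2 i' w.1.1))).
  apply: measurable_fun_pair.
    by apply: measurableT_comp; [exact: measurable_snd|exact: measurable_fst].
  apply: (measurableT_comp (measurable_add_coord i')
    (g := fun w : (R * R) * n.-tuple R => (w.2, w.1.1))).
  apply: measurable_fun_pair; first exact: measurable_snd.
  by apply: measurableT_comp; [exact: measurable_fst|exact: measurable_fst].
transitivity (gamma_int 1 (fun x : R => gamma_int (b ord0) (fun z : R =>
    gamma_tuple (fun j => b (lift ord0 j)) (fun y => f (tcons (z, add_coord y i' x)))))).
  congr (gamma_int 1 _); apply/funext => x /=; congr (gamma_int _ _).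
  apply/funext => z; congr (gamma_tuple _ _).
  by apply/funext => y; rewrite add_coord_tcons.
rewrite (gamma_int_swap 1 (b ord0) (f := fun w : R * R =>
    gamma_tuple (fun j => b (lift ord0 j)) (fun y => f (tcons (w.2, add_coord y i' w.1))))).
- congr (gamma_int _ _); apply/funext => z.
  rewrite (IH _ i' (fun y => f (tcons (z, y))))//.
  exact: (measurable_fun_pair2 z (measurable_comp_tcons1 mf)).
- exact: (measurable_gamma_tuple _ mg).
- by move=> w; apply: gamma_tuple_ge0.
Qed.

(** Induction on [q]: the measure of parameter [q.+1] is that of parameter [q] convolved with that
    of parameter 1, and both variables are added to the same coordinate. *)
Lemma gamma_tuple_add n (b : 'I_n -> nat) i q (f : n.-tuple R -> \bar R) :
  measurable_fun setT f -> (forall y, 0 <= f y) ->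
  gamma_int q (fun x => gamma_tuple b (fun y => f (add_coord y i x))) =
  gamma_tuple (fun j => b j + q * (j == i))%N f.
Proof.
elim: q f => [|q IH] f mf f0.
  rewrite /=; congr (gamma_tuple _ _); apply/funext => y; last first.
    congr f; apply: eq_from_tnth => j; rewrite tnth_mktuple addr0.
    by case: ifP.
  by rewrite mul0n addn0.
have mfi := measurable_comp_add_coord i mf.
rewrite -gamma_int1_conv.
- rewrite [RHS](_ : _ = gamma_tuple (fun j => (b j + q * (j == i)) + (j == i))%N f); last first.
    by congr (gamma_tuple _ _); apply/funext => j; rewrite mulSn addnAC addnA.
  rewrite -gamma_tuple_add1//; congr (gamma_int 1 _); apply/funext => u.
  rewrite -(IH (fun y => f (add_coord y i u)))//.
  + congr (gamma_int _ _); apply/funext => x; congr (gamma_tuple _ _).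
    apply/funext => y; congr f; apply: eq_from_tnth => j; rewrite !tnth_mktuple.
    by case: ifP => // _; rewrite addrA.
  + exact: (measurable_fun_pair2 u mfi).
- exact: (measurable_gamma_tuple b mfi).
- by move=> x; apply: gamma_tuple_ge0.
Qed.

Definition aggregate n d (c : 'I_n -> 'I_d) (y : n.-tuple R) : d.-tuple R :=
  [tuple (\sum_(t < n | c t == i) tnth y t)%R | i < d].

Lemma measurable_mktuple d' (T : measurableType d') n (g : 'I_n -> T -> R) :
  (forall i, measurable_fun setT (g i)) ->
  measurable_fun setT (fun z => [tuple g i z | i < n]).
Proof.
move=> mg; apply/measurable_fun_tnthP => i.
by rewrite (_ : _ \o _ = g i)//; apply/funext => z /=; rewrite tnth_mktuple.
Qed.

Lemma measurable_aggregate n d (c : 'I_n -> 'I_d) :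
  measurable_fun setT (aggregate c).
Proof.
apply: (measurable_mktuple (g := fun i (y : n.-tuple R) => \sum_(t < n | c t == i) tnth y t)%R) => i.
under eq_fun do rewrite big_mkcond /=.
apply: measurable_sum => t; case: (c t == i) => //.
exact: measurable_tnth.
Qed.

Lemma gamma_tuple0 n (f : n.-tuple R -> \bar R) :
  gamma_tuple (fun=> 0%N) f = f [tuple 0%R | i < n].
Proof.
elim: n f => [|n IH] f /=; first by congr f; apply: eq_from_tnth => -[].
rewrite IH; congr f; apply: eq_from_tnth => i; rewrite tnth_mktuple.
by case: (unliftP ord0 i) => [j ->|-> //]; rewrite tnthS tnth_mktuple.
Qed.

Lemma aggregate_tcons n d (c : 'I_n.+1 -> 'I_d) x (y : n.-tuple R) :
  aggregate c (tcons (x, y)) =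
  add_coord (aggregate (fun t => c (lift ord0 t)) y) (c ord0) x.
Proof.
apply: eq_from_tnth => i; rewrite !tnth_mktuple big_mkcond big_ord_recl /=.
under eq_bigr do rewrite tnthS.
rewrite -big_mkcond /= eq_sym tnth0; case: ifP => _; last by rewrite add0r.
by rewrite addrC.
Qed.

(** Induction on [n]: the first coordinate is added to entry [c ord0] of the aggregate of the
    others, which raises that parameter by [b ord0]. *)
Lemma gamma_tuple_aggregate n d (b : 'I_n -> nat) (c : 'I_n -> 'I_d)
    (f : d.-tuple R -> \bar R) :
  measurable_fun setT f -> (forall y, 0 <= f y) ->
  gamma_tuple b (fun y => f (aggregate c y)) = gamma_tuple (block_count b c) f.
Proof.
elim: n b c f => [|n IH] b c f mf f0.
  rewrite /= (_ : block_count b c = fun=> 0%N); last first.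
    by apply/funext => i; rewrite /block_count big_ord0.
  rewrite gamma_tuple0; congr f; apply: eq_from_tnth => i.
  by rewrite !tnth_mktuple big_ord0.
rewrite /=; transitivity (gamma_int (b ord0) (fun x =>
    gamma_tuple (block_count (fun i => b (lift ord0 i)) (fun t => c (lift ord0 t)))
      (fun y => f (add_coord y (c ord0) x)))).
  congr (gamma_int _ _); apply/funext => x.
  rewrite -(IH _ _ (fun y => f (add_coord y (c ord0) x)))//.
    congr (gamma_tuple _ _); apply/funext => y; congr f.
    exact: aggregate_tcons.
  exact: (measurable_fun_pair2 x (measurable_comp_add_coord (c ord0) mf)).
rewrite gamma_tuple_add//; congr (gamma_tuple _ _); apply/funext => i.
rewrite /block_count [in RHS]big_mkcond big_ord_recl -big_mkcond /= addnC eq_sym.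
by case: ifP; rewrite ?muln1 ?muln0.
Qed.

Lemma measurable_prod_gamma_den n (b : 'I_n -> nat) :
  measurable_fun setT (fun y : n.-tuple R => (\prod_i gamma_den (b i) (tnth y i))%R).
Proof.
apply: measurable_prod => i _.
apply: (measurableT_comp (measurable_gamma_den (b i)) (g := fun y : n.-tuple R => tnth y i)).
exact: measurable_tnth.
Qed.

(** When all parameters are positive the product measure has a density with respect to
    [lebesgue_tuple], the form in which the Dirichlet law is defined. *)
Lemma gamma_tuple_lebesgue n (b : 'I_n -> nat) (f : n.-tuple R -> \bar R) :
  measurable_fun setT f -> (forall y, 0 <= f y) ->
  gamma_tuple (fun i => (b i).+1) f =
  \int[lebesgue_tuple R n]_y (f y * (\prod_i gamma_den (b i) (tnth y i))%:E).
Proof.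
have p0 m (c : 'I_m -> nat) (y : m.-tuple R) :
    0 <= (\prod_i gamma_den (c i) (tnth y i))%:E.
  by rewrite lee_fin prodr_ge0// => i _; exact: gamma_den_ge0.
have mp m (c : 'I_m -> nat) :
    measurable_fun setT (fun y : m.-tuple R => (\prod_i gamma_den (c i) (tnth y i))%:E).
  by apply/measurable_EFinP; exact: measurable_prod_gamma_den.
elim: n b f => [|n IH] b f mf f0.
  rewrite /= integral_dirac//; last first.
    by apply: emeasurable_funM => //; exact: mp.
  by rewrite diracT mul1e big_ord0 mule1.
set g := fun y => f y * _.
have mg : measurable_fun setT g by apply: emeasurable_funM => //; exact: mp.
have g0 y : 0 <= g y by rewrite mule_ge0.
transitivity (\int[(mu \x lebesgue_tuple R n)%E]_z g (tcons z)); last first.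
  transitivity (\int[(mu \x lebesgue_tuple R n)%E]_(z in @tcons R n @^-1` setT)
      (g \o @tcons R n) z); first by rewrite preimage_setT.
  apply/esym; have mt : measurable_fun [set: measurableTypeR R * n.-tuple R] (@tcons R n).
    exact: measurable_tcons.
  have := ge0_integral_pushforward mt (mu \x lebesgue_tuple R n)%E measurableT mg (fun y _ => g0 y).
  exact.
rewrite (fubini_tonelli1 (m1 := mu) (m2 := lebesgue_tuple R n))//; last first.
  exact: measurable_comp_tcons1.
rewrite [LHS]/=; apply: eq_integral => x _.
have /= -> := IH (fun i => b (lift ord0 i)) (fun y => f (tcons (x, y)))
  (measurable_fun_pair2 x (measurable_comp_tcons1 mf)) (fun y => f0 _).
rewrite -ge0_integralZr//.
- apply: eq_integral => y _; rewrite /g -muleA; congr (_ * _).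
  rewrite big_ord_recl tnth0 -EFinM mulrC; congr (_ * _)%:E.
  by apply: eq_bigr => i _; rewrite tnthS.
- apply: emeasurable_funM; last exact: mp.
  exact: (measurable_fun_pair2 x (measurable_comp_tcons1 mf)).
- by move=> y _; rewrite mule_ge0//; exact: (p0 _ (fun i => b (lift ord0 i))).
- by rewrite lee_fin gamma_den_ge0.
Qed.

Definition scale_tuple n (s : R) (y : n.-tuple R) : n.-tuple R :=
  [tuple (s * tnth y i)%R | i < n].

Lemma measurable_scale_tuple n :
  measurable_fun setT (fun z : R * n.-tuple R => scale_tuple z.1 z.2).
Proof.
apply: (measurable_mktuple (g := fun i (z : R * n.-tuple R) => (z.1 * tnth z.2 i)%R)) => i.
apply: measurable_funM; first exact: measurable_fst.
by apply: (measurableT_comp (measurable_tnth i)); exact: measurable_snd.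
Qed.

Lemma scale_tcons n s x (y : n.-tuple R) :
  scale_tuple s (tcons (x, y)) = tcons ((s * x)%R, scale_tuple s y).
Proof.
apply: eq_from_tnth => i; rewrite tnth_mktuple.
by case: (unliftP ord0 i) => [j ->|-> //]; rewrite !tnthS tnth_mktuple.
Qed.

Lemma gamma_tuple_scale n (b : 'I_n -> nat) (s : R) (f : n.-tuple R -> \bar R) :
  (0 < s)%R -> measurable_fun setT f -> (forall y, 0 <= f y) ->
  gamma_tuple b f =
  (s ^+ (\sum_i b i))%:E * gamma_tuple b (fun y => f (scale_tuple s y)).
Proof.
move=> s0; elim: n b f => [|n IH] b f mf f0.
  by rewrite big_ord0 mul1e /=; congr f; apply: eq_from_tnth => -[].
have ms : measurable_fun setT (fun y => f (scale_tuple s y)).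
  by apply: (measurableT_comp mf); exact: (measurable_fun_pair2 s (@measurable_scale_tuple n.+1)).
rewrite big_ord_recl exprD EFinM -muleA [LHS]/= (gamma_intM _ s0).
- congr (_ * _); rewrite /= -gamma_intZ.
  + congr (gamma_int _ _); apply/funext => x.
    rewrite (IH _ (fun y => f (tcons ((s * x)%R, y))))//.
      congr (_ * gamma_tuple _ _); apply/funext => y.
      by rewrite scale_tcons.
    exact: (measurable_fun_pair2 (s * x)%R (measurable_comp_tcons1 mf)).
  + by rewrite exprn_ge0// ltW.
  + exact: (measurable_gamma_tuple_tcons _ ms).
  + by move=> x; apply: gamma_tuple_ge0.
- exact: measurable_gamma_tuple_tcons.
- by move=> x; apply: gamma_tuple_ge0.
Qed.

End gamma_tuple.

(** * Cone formula for the Dirichlet distribution *)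

Section Gamma_factorial.
Context {R : realType}.
Local Notation mu := (@lebesgue_measure R).

(** The bound x^(n+1) / (n+1)! <= exp x squeezes the function below (n+1)! / x. *)
Lemma cvg_exprn_expRN n : (x : R) ^+ n * expR (- x) @[x --> +oo] --> (0 : R).
Proof.
apply: (@squeeze_cvgr _ _ _ _ (cst 0) (fun x : R => n.+1`!%:R * x^-1)).
- near=> x; have x0 : 0 < x by near: x; exact: nbhs_pinfty_gt.
  rewrite mulr_ge0 ?exprn_ge0 ?expR_ge0 ?(ltW x0)//=.
  rewrite expRN ler_pdivrMr ?expR_gt0// mulrAC ler_pdivlMr// -exprSr mulrC.
  rewrite -ler_pdivrMr ?ltr0n ?fact_gt0//.
  by apply: le_trans (expR_ge1Dxn n (ltW x0)); rewrite lerDr ler01.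
- exact: cvg_cst.
- rewrite -(mulr0 n.+1`!%:R); apply: cvgM; first exact: cvg_cst.
  apply/gtr0_cvgV0; last exact: cvg_id.
  exact: nbhs_pinfty_gt.
Unshelve. all: by end_near. Qed.

(** The primitive of t^n exp (- t) that vanishes at infinity; the recursion is integration by
    parts. *)
Fixpoint Gamma_prim (n : nat) (t : R) : R :=
  if n is n'.+1 then n%:R * Gamma_prim n' t - t ^+ n * expR (- t)
  else - expR (- t).

Lemma Gamma_prim_derive n (t : R) :
  is_derive t (1 : R) (Gamma_prim n) (t ^+ n * expR (- t)).
Proof.
have dN : is_derive t (1 : R) (fun t : R => - t) (- 1) by exact: is_deriveN.
have dE : is_derive t (1 : R) (fun t : R => expR (- t)) (- expR (- t)).
  by apply: is_derive_eq; rewrite /GRing.scale /= mulrN1.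
have dX m : is_derive t (1 : R) (fun t : R => t ^+ m.+1) (m.+1%:R * t ^+ m).
  apply: DeriveDef; first exact: exprn_derivable.
  by rewrite exp_derive /= [LHS]mulr1.
elim: n => [|n IH].
  rewrite expr0 mul1r -[X in is_derive _ _ _ X]opprK; exact: is_deriveN.
have h1 := is_deriveZ (n.+1%:R : R) IH.
have h2 := is_deriveM (dX n) dE.
have h3 := is_deriveB h1 h2.
apply: (@is_derive_eq _ _ _ _ _ _ _ _ h3).
rewrite /GRing.scale /=; ring.
Qed.

Lemma Gamma_prim0 n : Gamma_prim n 0 = - n`!%:R.
Proof.
elim: n => [|n IH] /=; first by rewrite oppr0 expR0.
by rewrite IH expr0n mul0r subr0 mulrN factS natrM.
Qed.

Lemma Gamma_prim_cvg n : Gamma_prim n x @[x --> +oo] --> (0 : R).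
Proof.
elim: n => [|n IH] /=; first by rewrite -[X in _ --> X]oppr0; apply: cvgN; exact: cvgr_expR.
rewrite -[X in _ --> X](subr0 0); apply: cvgB; last exact: cvg_exprn_expRN.
by rewrite -(mulr0 n.+1%:R); apply: cvgM => //; exact: cvg_cst.
Qed.

Lemma Gamma_fact n : Gamma n.+1%:R = n`!%:R :> R.
Proof.
have cf : continuous (fun t : R => t ^+ n * expR (- t)).
  move=> t; apply: cvgM; first exact: exprn_continuous.
  apply: (@continuous_comp _ _ _ (-%R) expR); last exact: continuous_expR.
  exact: opp_continuous.
have cF : continuous (Gamma_prim n).
  move=> y; apply: differentiable_continuous; apply/derivable1_diffP.
  by have [] := Gamma_prim_derive n y.
rewrite /Gamma /Rintegral.
transitivity (fine (\int[mu]_(t in `]0%R, +oo[) (t ^+ n * expR (- t))%:E)%E).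
  congr fine; apply: eq_integral => t; rewrite inE /= in_itv /= andbT => t0.
  by rewrite -natr1 addrK powR_mulrn// ltW.
rewrite integral_itv_obnd_cbnd; last first.
  by apply/measurable_EFinP; apply: measurable_funTS; exact: continuous_measurable_fun.
rewrite (ge0_continuous_FTC2y _ _ (@Gamma_prim_cvg n)).
- by rewrite Gamma_prim0 /= sub0r opprK.
- by move=> x x0; rewrite mulr_ge0 ?exprn_ge0 ?expR_ge0.
- exact: continuous_subspaceT.
- by move=> x _; have [] := Gamma_prim_derive n x.
- exact/cvg_at_right_filter/cF.
- by move=> x _; rewrite derive1E; have [_ ->] := Gamma_prim_derive n x.
Qed.

End Gamma_factorial.

(** * Separation of the sum from the direction *)

Section cone.
Context {R : realType}.
Local Notation mu := (@lebesgue_measure R).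
Local Open Scope ereal_scope.

Definition tuple_sum n (y : n.-tuple R) : R := (\sum_(i < n) tnth y i)%R.

Lemma measurable_tuple_sum n : measurable_fun setT (@tuple_sum n).
Proof. by apply: measurable_sum => i; exact: measurable_tnth. Qed.

Lemma tuple_sum_tcons n x (y : n.-tuple R) :
  tuple_sum (tcons (x, y)) = (x + tuple_sum y)%R.
Proof.
rewrite /tuple_sum big_ord_recl tnth0; congr (_ + _)%R.
by apply: eq_bigr => i _; rewrite tnthS.
Qed.

Lemma tuple_sum_scale n s (y : n.-tuple R) :
  tuple_sum (scale_tuple s y) = (s * tuple_sum y)%R.
Proof.
by rewrite /tuple_sum mulr_sumr; apply: eq_bigr => i _; rewrite tnth_mktuple.
Qed.

Lemma tuple_sum_aggregate n d (c : 'I_n -> 'I_d) (y : n.-tuple R) :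
  tuple_sum (aggregate c y) = tuple_sum y.
Proof.
rewrite /tuple_sum (partition_big c predT)//=.
by apply: eq_bigr => i _; rewrite tnth_mktuple.
Qed.

Lemma scale_aggregate n d (c : 'I_n -> 'I_d) s (y : n.-tuple R) :
  scale_tuple s (aggregate c y) = aggregate c (scale_tuple s y).
Proof.
apply: eq_from_tnth => i; rewrite !tnth_mktuple mulr_sumr.
by apply: eq_bigr => t _; rewrite tnth_mktuple.
Qed.

(* As [gamma_den 0] is the indicator of the positive half-line, this is the
   indicator of [0 < s < 1 /\ y / s \in C]. *)
Definition cone_ind n (C : set (n.-tuple R)) (y : n.-tuple R) : \bar R :=
  let s := tuple_sum y in
  (gamma_den 0 s * gamma_den 0 (1 - s) * \1_C (scale_tuple (s `^ (-1)) y))%:E.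

Lemma cone_ind_ge0 n (C : set (n.-tuple R)) y : 0 <= cone_ind C y.
Proof. by rewrite lee_fin !mulr_ge0// gamma_den_ge0. Qed.

Lemma measurable_cone_ind n (C : set (n.-tuple R)) : measurable C ->
  measurable_fun setT (cone_ind C).
Proof.
move=> mC; apply/measurable_EFinP.
have ms := @measurable_tuple_sum n.
apply: measurable_funM.
  apply: measurable_funM; first exact: (measurableT_comp (measurable_gamma_den 0) ms).
  apply: (measurableT_comp (measurable_gamma_den 0)
    (g := fun y : n.-tuple R => (1 - tuple_sum y)%R)).
  exact: measurable_funB.
apply: (measurableT_comp (measurable_indic mC)
  (g := fun y : n.-tuple R => scale_tuple (tuple_sum y `^ (-1)) y)).
apply: (measurableT_comp (@measurable_scale_tuple R n)
  (g := fun y : n.-tuple R => (tuple_sum y `^ (-1), y)%R)).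
apply: measurable_fun_pair; last exact: measurable_id.
exact: (measurableT_comp (measurable_powR (-1)) ms).
Qed.

Lemma gamma_denM q (s x : R) : (0 < s)%R ->
  gamma_den q (s * x)%R = (s ^+ q * gamma_den q x)%R.
Proof.
move=> s0; have [x0|x0] := leP x 0%R.
  by rewrite !gamma_den_le0E ?mulr0// pmulr_rle0.
by rewrite !gamma_den_gt0E ?mulr_gt0// exprMn mulrA.
Qed.

Lemma gamma_denE0 q (x : R) : (q`!%:R * gamma_den q x = gamma_den 0 x * x ^+ q)%R.
Proof.
have [x0|x0] := leP x 0%R; first by rewrite !gamma_den_le0E// mulr0 mul0r.
rewrite !gamma_den_gt0E// expr0 fact0 divr1 mul1r mulrC divfK//.
Qed.

(* The integral of this function against the last [d] gamma densities is the
   law [dirichlet_pos] up to normalization. *)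
Definition simplex_ind d q (C : set (d.+1.-tuple R)) (y : d.-tuple R) : \bar R :=
  (gamma_den q (1 - tuple_sum y) * \1_C (tcons (1 - tuple_sum y, y)))%:E.

Lemma measurable_tcons_sub d : measurable_fun setT
  (fun z : R * d.-tuple R => tcons ((z.1 - tuple_sum z.2)%R, z.2)).
Proof.
apply: (measurableT_comp (@measurable_tcons R d)
  (g := fun z : R * d.-tuple R => ((z.1 - tuple_sum z.2)%R, z.2))).
apply: measurable_fun_pair; last exact: measurable_snd.
apply: measurable_funB; first exact: measurable_fst.
by apply: (measurableT_comp (@measurable_tuple_sum d)); exact: measurable_snd.
Qed.

Lemma measurable_simplex_ind d q (C : set (d.+1.-tuple R)) : measurable C ->
  measurable_fun setT (simplex_ind q C).
Proof.
move=> mC; apply/measurable_EFinP; apply: measurable_funM.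
  apply: (measurableT_comp (measurable_gamma_den q)
    (g := fun y : d.-tuple R => (1 - tuple_sum y)%R)).
  by apply: measurable_funB => //; exact: measurable_tuple_sum.
apply: (measurableT_comp (measurable_indic mC)
  (g := fun y : d.-tuple R => tcons (1 - tuple_sum y, y)%R)).
exact: (measurable_fun_pair2 (1%R : R) (@measurable_tcons_sub d)).
Qed.

Lemma simplex_ind_ge0 d q (C : set (d.+1.-tuple R)) y : 0 <= simplex_ind q C y.
Proof. by rewrite lee_fin mulr_ge0// gamma_den_ge0. Qed.

(* The translation [x_0 = s - (x_1 + ... + x_d)] makes the sum [s] a variable of
   integration; rescaling the other coordinates by [s] then separates it. *)
Lemma gamma_tuple_cone d (b : 'I_d.+1 -> nat) (C : set (d.+1.-tuple R)) :
  measurable C ->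
  gamma_tuple (fun i => (b i).+1) (cone_ind C) =
  ((\sum_i (b i).+1)%N%:R^-1)%:E *
  gamma_tuple (fun i => (b (lift ord0 i)).+1) (simplex_ind (b ord0) C).
Proof.
move=> mC; pose b' i := (b (lift ord0 i)).+1.
(* [F] below is the integrand in the original coordinates; [G] is the same integrand once the first
   variable is the sum s instead of x_0. *)
pose G (z : R * d.-tuple R) : \bar R :=
  (gamma_den (b ord0) (z.1 - tuple_sum z.2))%:E *
  cone_ind C (tcons ((z.1 - tuple_sum z.2)%R, z.2)).
have mG : measurable_fun setT G.
  apply: emeasurable_funM; last first.
    exact: (measurableT_comp (measurable_cone_ind mC) (@measurable_tcons_sub d)).
  apply: (measurableT_comp (measurable_gamma_denE (b ord0))
    (g := fun z : R * d.-tuple R => (z.1 - tuple_sum z.2)%R)).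
  apply: measurable_funB; first exact: measurable_fst.
  by apply: (measurableT_comp (@measurable_tuple_sum d)); exact: measurable_snd.
have G0 z : 0 <= G z by rewrite mule_ge0 ?cone_ind_ge0// lee_fin gamma_den_ge0.
pose F (z : R * d.-tuple R) : \bar R :=
  (gamma_den (b ord0) z.1)%:E * cone_ind C (tcons z).
have mF : measurable_fun setT F.
  apply: emeasurable_funM; last exact: (measurable_comp_tcons1 (measurable_cone_ind mC)).
  by apply: (measurableT_comp (measurable_gamma_denE (b ord0))); exact: measurable_fst.
have F0 z : 0 <= F z by rewrite mule_ge0 ?cone_ind_ge0// lee_fin gamma_den_ge0.
have sG s y : G (s, y) = (gamma_den 0 s * gamma_den 0 (1 - s) *
    gamma_den (b ord0) (s - tuple_sum y) *
    \1_C (scale_tuple (s `^ (-1)) (tcons ((s - tuple_sum y)%R, y))))%:E.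
  rewrite /G /cone_ind /= tuple_sum_tcons subrK -EFinM; congr EFin; ring.
transitivity (\int[mu]_x gamma_tuple b' (fun y => F (x, y))).
  apply: eq_integral => x _; rewrite muleC /F/=.
  rewrite -gamma_tupleZ ?gamma_den_ge0//.
  - exact: (measurable_fun_pair2 x (measurable_comp_tcons1 (measurable_cone_ind mC))).
  - by move=> y; exact: cone_ind_ge0.
rewrite (gamma_tuple_tonelli mu b' mF F0).
transitivity (gamma_tuple b' (fun y => \int[mu]_s G (s, y))).
  congr (gamma_tuple _ _); apply/funext => y.
  rewrite (@ge0_integral_affine _ 1 (- tuple_sum y) (fun x => F (x, y)))//.
  - by rewrite mul1e; apply: eq_integral => s _; rewrite /F/G /= mul1r.
  - exact: (measurable_fun_pair1 y mF).
rewrite -(gamma_tuple_tonelli mu b' mG G0).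
set H := gamma_tuple _ (simplex_ind _ _).
have H0 : 0 <= H by apply: gamma_tuple_ge0 => y; exact: simplex_ind_ge0.
(* The power of s released by the rescaling: [b ord0] from the density of x_0 and [b' i] from each
   other coordinate. *)
pose q := (b ord0 + \sum_i b' i)%N.
have kq : (\sum_i (b i).+1 = q.+1)%N by rewrite big_ord_recl.
transitivity (\int[mu]_s ((q`!%:R)%:E * ((gamma_den q s)%:E * (gamma_den 0 (1 - s))%:E) * H)).
  apply: eq_integral => s _.
  rewrite muleA -EFinM gamma_denE0.
  (* For s <= 0 both sides vanish through [gamma_den 0 s]; rescaling by s requires s > 0. *)
  have [s0|s0] := leP s 0%R.
    rewrite (gamma_den_le0E _ s0) !mul0r mul0e -[RHS](mul0e (gamma_tuple b' (fun y => G (s, y)))).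
    rewrite -gamma_tupleZ//.
    - congr (gamma_tuple _ _); apply/funext => y.
      by rewrite mul0e sG gamma_den_le0E// !mul0r.
    - exact: (measurable_fun_pair2 s mG).
  rewrite (gamma_tuple_scale b' s0 (measurable_fun_pair2 s mG))//.
  rewrite (_ : (fun y => G (s, scale_tuple s y)) = fun y =>
     (gamma_den 0 s * gamma_den 0 (1 - s) * s ^+ b ord0)%:E * simplex_ind (b ord0) C y); last first.
    apply/funext => y; rewrite sG /simplex_ind -EFinM; congr EFin.
    have -> : (s - tuple_sum (scale_tuple s y) = s * (1 - tuple_sum y))%R.
      by rewrite tuple_sum_scale mulrBr mulr1.
    rewrite gamma_denM// -scale_tcons.
    rewrite (_ : scale_tuple _ (scale_tuple _ _) = tcons (1 - tuple_sum y, y)%R).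
      by rewrite -!mulrA.
    apply: eq_from_tnth => i; rewrite !tnth_mktuple powR_inv1 ?(ltW s0)//.
    by rewrite mulKf// gt_eqF.
  rewrite gamma_tupleZ.
  - rewrite muleA -!EFinM; congr (_%:E * _); rewrite /q exprD; ring.
  - by rewrite !mulr_ge0 ?gamma_den_ge0// exprn_ge0// ltW.
  - exact: measurable_simplex_ind.
  - by move=> y; exact: simplex_ind_ge0.
have mgg : measurable_fun setT (fun s : R => (gamma_den q s)%:E * (gamma_den 0 (1 - s))%:E).
  apply: emeasurable_funM; first exact: measurable_gamma_denE.
  apply: (measurableT_comp (measurable_gamma_denE 0) (g := fun s : R => (1 - s)%R)).
  exact: measurable_funB.
have gg0 s : 0 <= (gamma_den q s)%:E * (gamma_den 0 (1 - s))%:E.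
  by rewrite mule_ge0// lee_fin gamma_den_ge0.
rewrite ge0_integralZr//.
- congr (_ * _); rewrite ge0_integralZl_EFin// ?ler0n//.
  (* The integral of s^q over (0, 1) is a convolution evaluated at 1, equal to q! / (q+1)! after
     normalization. *)
  rewrite gamma_den_conv gamma_den_gt0E// expr1n -EFinM kq; congr EFin.
  rewrite factS natrM; field.
  by rewrite -(natrD _ 1 q) !pnatr_eq0 /= -lt0n fact_gt0.
- by apply: emeasurable_funM => //; exact: measurable_cst.
- by move=> s _; rewrite mule_ge0// lee_fin ler0n.
Qed.

End cone.

(** * Dirichlet laws with integer parameters *)

Section dirichlet_nat.
Context {R : realType}.
Local Notation mu := (@lebesgue_measure R).

(** The Gamma values become factorials, and the constraints on [x] are absorbed by the vanishing of
    [gamma_den] on nonpositive reals. *)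
Lemma dirichlet_density_nat d (b : 'I_d.+1 -> nat) (x : d.-tuple R) :
  dirichlet_density (fun i => (b i).+1%:R) x =
  ((\sum_i (b i).+1)%N.-1)`!%:R *
  (gamma_den (b ord0) (1 - tuple_sum x) *
   \prod_(i < d) gamma_den (b (lift ord0 i)) (tnth x i)).
Proof.
rewrite /dirichlet_density -/(tuple_sum x); case: ifPn.
  move=> /andP[/forallP x0 s1].
  have -> : \sum_i (b i).+1%:R = ((\sum_i (b i).+1)%N.-1).+1%:R :> R.
    by rewrite -natr_sum prednK// big_ord_recl.
  under [\prod_(i < d.+1) _]eq_bigr do rewrite Gamma_fact.
  rewrite Gamma_fact -mulrA; congr (_ * _).
  rewrite big_ord_recl invfM mulrACA; congr (_ * _).
    rewrite gamma_den_gt0E ?subr_gt0// mulrC -natr1 addrK powR_mulrn//.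
    by rewrite subr_ge0 ltW.
  rewrite -prodfV -big_split /=; apply: eq_bigr => i _.
  rewrite gamma_den_gt0E// mulrC -natr1 addrK powR_mulrn//.
  exact: ltW.
rewrite negb_and => /orP[|s1]; last first.
  by rewrite gamma_den_le0E ?mul0r ?mulr0// subr_le0 leNgt.
rewrite negb_forall => /existsP[i xi].
suff -> : \prod_(i < d) gamma_den (b (lift ord0 i)) (tnth x i) = 0 by rewrite !mulr0.
by rewrite (bigD1 i)//= gamma_den_le0E ?mul0r// leNgt.
Qed.

Local Open Scope ereal_scope.

Lemma dirichlet_pos_simplex d (b : 'I_d.+1 -> nat) (C : set (d.+1.-tuple R)) :
  measurable C ->
  dirichlet_pos (fun i => (b i).+1%:R) C =
  ((\sum_i (b i).+1)%N.-1)`!%:R%:E *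
  gamma_tuple (fun i => (b (lift ord0 i)).+1) (simplex_ind (b ord0) C).
Proof.
move=> mC; rewrite /= /pushforward.
rewrite (gamma_tuple_lebesgue (fun i => b (lift ord0 i))); last 2 first.
- exact: measurable_simplex_ind.
- exact: simplex_ind_ge0.
rewrite -ge0_integralZl_EFin//.
- rewrite [LHS]integral_mkcond; apply: eq_integral => x _; rewrite /patch.
  rewrite dirichlet_density_nat /simplex_ind indicE.
  set p := (X in X \in _); set p' := tcons _.
  have -> : (p' \in C) = (p \in (fun x => [tuple of (1 - \sum_(i < d) tnth x i)%R :: x]) @^-1` C).
    by apply/idP/idP; rewrite !inE.
  case: ifP => _.
    by rewrite mulr1 -!EFinM.
  by rewrite mulr0 mul0e mule0.
- by move=> x _; rewrite mule_ge0 ?simplex_ind_ge0// lee_fin prodr_ge0// => i _; exact: gamma_den_ge0.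
- apply: emeasurable_funM; first exact: measurable_simplex_ind.
  apply/measurable_EFinP.
  exact: (measurable_prod_gamma_den (fun i => b (lift ord0 i))).
Qed.

(** With k the sum of the parameters, the density carries (k - 1)! and integrating out the sum in
    [gamma_tuple_cone] costs a factor 1 / k; together they account for k!. *)
Lemma dirichlet_pos_cone n (b : 'I_n -> nat) (C : set (n.-tuple R)) :
  (0 < n)%N -> (forall i, 0 < b i)%N -> measurable C ->
  dirichlet_pos (fun i => (b i)%:R) C =
  ((\sum_i b i)%N`!%:R)%:E * gamma_tuple b (cone_ind C).
Proof.
case: n b C => [//|d] b C _ b0 mC.
have -> : b = fun i => (b i).-1.+1 by apply/funext => i; rewrite prednK.
rewrite (dirichlet_pos_simplex (fun i => (b i).-1))// (gamma_tuple_cone (fun i => (b i).-1))//.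
rewrite muleA -EFinM; congr (_%:E * _).
rewrite big_ord_recl /= addSn factS natrM mulrAC divff ?mul1r//.
Qed.

(** Aggregation is linear and preserves the sum of the coordinates, hence commutes with
    normalization. *)
Lemma cone_ind_aggregate n d (c : 'I_n -> 'I_d) (C : set (d.-tuple R)) y :
  cone_ind (aggregate c @^-1` C) y = cone_ind C (aggregate c y).
Proof.
by rewrite /cone_ind tuple_sum_aggregate scale_aggregate !indicE.
Qed.

Lemma measurable_preimage_aggregate n d (c : 'I_n -> 'I_d) (C : set (d.-tuple R)) :
  measurable C -> measurable (aggregate c @^-1` C).
Proof.
by move=> mC; rewrite -[X in measurable X]setTI; exact: measurable_aggregate.
Qed.

Lemma gamma_tuple_cone_aggregate n d (c : 'I_n -> 'I_d) (b : 'I_n -> nat)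
    (C : set (d.-tuple R)) : measurable C ->
  gamma_tuple b (cone_ind (aggregate c @^-1` C)) =
  gamma_tuple (block_count b c) (cone_ind C).
Proof.
move=> mC; rewrite -gamma_tuple_aggregate.
- by congr (gamma_tuple _ _); apply/funext => y; rewrite cone_ind_aggregate.
- exact: measurable_cone_ind.
- by move=> y; exact: cone_ind_ge0.
Qed.

(* Extends the cone formula to vanishing parameters: the embedding of the face
   spanned by the positive ones is itself an aggregation. *)
Lemma dirichlet_cone n (b : 'I_n -> nat) (C : set (n.-tuple R)) :
  (0 < \sum_i b i)%N -> measurable C ->
  dirichlet (fun i => (b i)%:R) C =
  ((\sum_i b i)%N`!%:R)%:E * gamma_tuple b (cone_ind C).
Proof.
move=> b_gt0 mC; rewrite /dirichlet.
set T := [pred i | _]; rewrite /pushforward.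
have Tb i : (i \in T) = (0 < b i)%N by rewrite !inE /= ltr0n.
rewrite -/(@aggregate R #|T| n (@enum_val _ T)).
(* An index outside [T] receives no coordinate, hence the parameter 0, which is the value of [b]
   there. *)
have bE : block_count (fun j : 'I_#|T| => b (enum_val j)) (@enum_val _ T) = b.
  apply/funext => i; rewrite /block_count.
  have [iT|iT] := boolP (i \in T).
    rewrite (bigD1 (enum_rank_in iT i)) ?enum_rankK_in//= big1 ?addn0//.
    move=> j /andP[/eqP ji]; case/eqP; apply: enum_val_inj.
    by rewrite enum_rankK_in.
  rewrite big1 => [|j /eqP ji]; last by move: iT; rewrite -ji enum_valP.
  by move: iT; rewrite Tb lt0n negbK => /eqP ->.
have sE : (\sum_(j < #|T|) b (enum_val j) = \sum_i b i)%N.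
  by rewrite -(sum_block_count _ (@enum_val _ T)) bE.
rewrite (dirichlet_pos_cone (b := fun j : 'I_#|T| => b (enum_val j))).
- by rewrite sE gamma_tuple_cone_aggregate// bE.
- apply/card_gt0P; move: b_gt0; rewrite lt0n sum_nat_eq0 negb_forall => /existsP[i].
  by rewrite implyTb -lt0n -Tb => iT; exists i.
- by move=> j; rewrite -Tb enum_valP.
- exact: measurable_preimage_aggregate.
Qed.

(** Both cone formulas carry the same factorial, since merging coordinates preserves the sum of the
    parameters. *)
Lemma dirichlet_aggregate n d (c : 'I_n -> 'I_d) (b : 'I_n -> nat)
    (C : set (d.-tuple R)) : (0 < \sum_i b i)%N -> measurable C ->
  dirichlet (fun i => (b i)%:R) (aggregate c @^-1` C) =
  dirichlet (fun i => (block_count b c i)%:R) C.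
Proof.
move=> b0 mC; have mCc := measurable_preimage_aggregate c mC.
by rewrite !dirichlet_cone ?sum_block_count// gamma_tuple_cone_aggregate.
Qed.

Lemma le_gamma_tuple n (b : 'I_n -> nat) (f g : n.-tuple R -> \bar R) :
  measurable_fun setT f -> measurable_fun setT g ->
  (forall y, 0 <= f y) -> (forall y, f y <= g y) ->
  gamma_tuple b f <= gamma_tuple b g.
Proof.
elim: n b f g => [b f g _ _ _ fg|n IH b f g mf mg f0 fg]; first exact: fg.
have g0 y : 0 <= g y by exact: le_trans (fg y).
have le x : gamma_tuple (fun i => b (lift ord0 i)) (fun y => f (tcons (x, y))) <=
    gamma_tuple (fun i => b (lift ord0 i)) (fun y => g (tcons (x, y))).
  by apply: IH => //; exact: (measurable_fun_pair2 x (measurable_comp_tcons1 _)).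
rewrite /=; case: (b ord0) => [|p] /=; first exact: le.
apply: ge0_le_integral => //.
- by move=> x _; rewrite mule_ge0 ?gamma_tuple_ge0// lee_fin gamma_den_ge0.
- apply: emeasurable_funM; last exact: measurable_gamma_denE.
  exact: measurable_gamma_tuple_tcons.
- apply: emeasurable_funM; last exact: measurable_gamma_denE.
  exact: measurable_gamma_tuple_tcons.
- by move=> x _; rewrite lee_wpmul2r// lee_fin gamma_den_ge0.
Qed.

Lemma dirichlet_ge0 n (b : 'I_n -> nat) (C : set (n.-tuple R)) :
  (0 < \sum_i b i)%N -> measurable C -> 0 <= dirichlet (fun i => (b i)%:R) C.
Proof.
move=> b0 mC; rewrite dirichlet_cone// mule_ge0 ?lee_fin ?ler0n//.
by apply: gamma_tuple_ge0 => y; exact: cone_ind_ge0.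
Qed.

Lemma dirichlet_fin_num n (b : 'I_n -> nat) (C : set (n.-tuple R)) :
  (0 < \sum_i b i)%N -> measurable C ->
  dirichlet (fun i => (b i)%:R) C \is a fin_num.
Proof.
move=> b0 mC; rewrite ge0_fin_numE ?dirichlet_ge0//.
apply: (@le_lt_trans _ _ (dirichlet (fun i => (b i)%:R) setT)).
  rewrite !dirichlet_cone// lee_wpmul2l ?lee_fin ?ler0n//.
  apply: le_gamma_tuple => [||y|y].
  - exact: measurable_cone_ind.
  - exact: measurable_cone_ind.
  - exact: cone_ind_ge0.
  rewrite lee_fin ler_wpM2l ?mulr_ge0 ?gamma_den_ge0//.
  by rewrite !indicE in_setT ler_nat leq_b1.
(* The total mass is computed after merging all coordinates into one, where it is the value at 1 of
   a convolution of gamma densities. *)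
rewrite -[setT](preimage_setT (aggregate (fun=> ord0 : 'I_1))).
rewrite dirichlet_aggregate// dirichlet_cone ?sum_block_count//=.
have -> : block_count b (fun=> ord0 : 'I_1) ord0 = (\sum_i b i)%N.
  by apply: eq_bigl => i.
case: (\sum_i b i)%N b0 => [//|q] _ /=.
rewrite (_ : integral _ _ _ = \int[mu]_x ((gamma_den q x)%:E * (gamma_den 0 (1 - x))%:E)).
  by rewrite gamma_den_conv -EFinM ltry.
apply: eq_integral => x _; rewrite /cone_ind indicE in_setT mulr1 tuple_sum_tcons.
rewrite /tuple_sum big_ord0 addr0 -!EFinM; congr EFin; rewrite mulrAC.
congr (_ * _)%R; have [x0|x0] := leP x 0%R; first by rewrite !gamma_den_le0E// mul0r.
by rewrite [gamma_den 0 x]gamma_den_gt0E// expr0 fact0 divr1 mul1r.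
Qed.

End dirichlet_nat.

(** * Conditioning on the block sizes *)

Lemma measure_bigcup_fintype d (T : measurableType d) (R : realType)
    (mu : {measure set T -> \bar R}) (I : finType) (P : pred I) (F : I -> set T) :
  (forall i, measurable (F i)) -> trivIset setT F ->
  (mu (\bigcup_(i in [set i | P i]) F i) = \sum_(i | P i) mu (F i))%E.
Proof.
move=> mF tF; rewrite measure_fin_bigcup//; last 2 first.
- exact: finite_finset.
- exact: sub_trivIset tF.
transitivity (\sum_(i <- enum P) mu (F i))%E; last by rewrite big_enum.
rewrite [RHS]fsbig_seq ?enum_uniq// (_ : [set` enum P] = [set i | P i])//.
by apply/seteqP; split=> i /=; rewrite mem_enum.
Qed.

Lemma measurable_tuple_nat_set1 (k : nat) (m : k.-tuple nat) : measurable [set m].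
Proof.
rewrite (_ : [set m] = \bigcap_(j in [set: 'I_k]) ((@tnth k nat)^~ j @^-1` [set tnth m j])).
  apply: fin_bigcap_measurable => [|j _]; first exact: finite_finset.
  by rewrite -[X in measurable X]setTI; exact: measurable_tnth.
apply/seteqP; split => [x -> //|x h]; apply: eq_from_tnth => j; exact: h.
Qed.

(** The event on the [X t] is a preimage under [first_terms n X], so independence detaches [W];
    mutual independence then gives the product over t. [Q] is a bare set function because
    [cond_prob] is one. *)
Lemma allocation_prob dT (T : measurableType dT) dO (Omega : measurableType dO)
    (R : realType) (Q : set T -> \bar R) n (X : nat -> T -> Omega)
    (W : T -> n.-tuple R) (nu : set Omega -> \bar R) (muW : set (n.-tuple R) -> \bar R)
    d (A : 'I_d -> set Omega) (c : 'I_n -> 'I_d) (D : set (n.-tuple R)) :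
  iid Q (fun t : 'I_n => X t) nu -> has_law Q W muW ->
  independent Q (first_terms n X) W ->
  (forall i, measurable (A i)) -> measurable D ->
  (Q ([set w | forall t : 'I_n, A (c t) (X t w)] `&` W @^-1` D) =
   \prod_(t < n) nu (A (c t)) * muW D)%E.
Proof.
move=> [Xlaw Xind] [_ Wlaw] ind mA mD.
pose B : set (n.-tuple Omega) := \bigcap_(t in [set: 'I_n]) ((@tnth n Omega)^~ t @^-1` A (c t)).
have mB : measurable B.
  apply: fin_bigcap_measurable => [|t _]; first exact: finite_finset.
  by rewrite -[X in measurable X]setTI; exact: measurable_tnth.
have EB : [set w | forall t : 'I_n, A (c t) (X t w)] = first_terms n X @^-1` B.
  apply/seteqP; split=> w /= h t; first by move=> _; rewrite /= tnth_mktuple; exact: h.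
  by have := h t I; rewrite /= tnth_mktuple.
rewrite EB ind// -Wlaw//; congr (_ * _)%E; rewrite -EB.
have -> : [set w | forall t : 'I_n, A (c t) (X t w)] =
    \bigcap_(t in [set: 'I_n]) (X t @^-1` A (c t)).
  by apply/seteqP; split=> w /= h t; [move=> _; exact: h|exact: h].
rewrite Xind; last by move=> t; exact: mA.
by apply: eq_bigr => t _; rewrite -(Xlaw t).2.
Qed.

Lemma poch_gt0 (R : realType) (a : R) n : 0 < a -> 0 < poch a n.
Proof. by move=> a0; apply: prodr_gt0 => i _; rewrite ltr_wpDr. Qed.

(** Positivity of the conditioning event allows its probability to be cancelled. *)
Lemma ewens_pmf_gt0 (R : realType) (k : nat) (a : R) (m : k.-tuple nat) :
  0 < a -> 0 < ewens_pmf a m.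
Proof.
move=> a0; rewrite mulr_gt0// divr_gt0 ?exprn_gt0 ?poch_gt0 ?ltr0n ?fact_gt0//.
by apply: prodn_gt0 => j; rewrite muln_gt0 expn_gt0 fact_gt0.
Qed.

Lemma tuple_of_ffun_inj k N : injective (@tuple_of_ffun k N).
Proof.
move=> f g /(congr1 (fun m => tnth m)) fg; apply/ffunP => j; apply: val_inj.
by have := congr1 (@^~ j) fg; rewrite /= !tnth_mktuple.
Qed.

Lemma weight_tuple_of_ffun k (m : k.-tuple nat) : weight m = k ->
  exists f : {ffun 'I_k -> 'I_k.+1}, m = tuple_of_ffun f.
Proof.
move=> mk; exists [ffun j => inord (tnth m j)]; apply: eq_from_tnth => j.
rewrite tnth_mktuple ffunE inordK// ltnS -[leqRHS]mk /weight (bigD1 j)//=.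
by rewrite mulSn -addnA leq_addr.
Qed.

(** The Dirac mass at an atom charges exactly the cell containing it, so the masses of the cells are
    the weights aggregated along the cell map. *)
Lemma fine_weighted_dirac dO (Omega : measurableType dO) (R : realType) n
    (W : n.-tuple R) (X : n.-tuple Omega) d (idx : Omega -> 'I_d)
    (A : 'I_d -> set Omega) (AE : forall i x, A i x <-> idx x = i) i :
  fine (weighted_dirac W X (A i)) =
  tnth (aggregate (fun t => idx (tnth X t)) W) i.
Proof.
rewrite tnth_mktuple /weighted_dirac [RHS]big_mkcond /=.
rewrite (eq_bigr (fun t => (if idx (tnth X t) == i then tnth W t else 0)%:E)); last first.
  move=> t _; rewrite diracE; case: eqP => [/AE Ai|Ai]; first by rewrite mem_set// mule1.
  by rewrite memNset ?mule0// => /AE.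
by rewrite sumEFin.
Qed.

Lemma partition_index (Omega : Type) d (A : 'I_d -> set Omega) :
  trivIset setT A -> \bigcup_(i in setT) A i = setT ->
  exists idx : Omega -> 'I_d, forall i x, A i x <-> idx x = i.
Proof.
move=> tA UA.
have ex x : exists i, A i x.
  by have : [set: Omega] x by []; rewrite -UA => -[i _ Aix]; exists i.
pose idx x := sval (cid (ex x)); exists idx => i x.
have idxP : A (idx x) x by rewrite /idx; case: cid.
split=> [Ai|<-//]; have /trivIsetP/(_ (idx x) i I I) := tA.
by case: eqP => // _ /(_ isT) /seteqP[+ _] => /(_ x) []; split.
Qed.

(** * Law of the masses of the cells *)

Section conditioning.
Variables (R : realType)
  (dO : measure_display) (Omega : measurableType dO)
  (alpha : {measure set Omega -> \bar R}) (a : R)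
  (alphaT : alpha [set: Omega] = a%:E) (a_gt0 : 0 < a)
  (k : nat) (k_gt0 : (0 < k)%N)
  (dT : measure_display) (T : measurableType dT) (Pr : probability T R)
  (M : {RV Pr >-> k.-tuple nat})
  (X : nat -> {RV Pr >-> Omega}) (W : nat -> {RV Pr >-> R})
  (M_weight : {ae Pr, forall w, weight (M w) = k})
  (M_ewens : forall m : k.-tuple nat, weight m = k ->
     Pr (M @^-1` [set m]) = (ewens_pmf a m)%:E)
  (X_iid : forall m : k.-tuple nat, weight m = k ->
     iid (cond_prob Pr (M @^-1` [set m])) (fun t : 'I_(nblocks m) => X t)
       (fun A => alpha A / a%:E)%E)
  (W_dirichlet : forall m : k.-tuple nat, weight m = k ->
     has_law (cond_prob Pr (M @^-1` [set m])) (first_terms (nblocks m) W)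
       (dirichlet (fun t => (block_sizes t)%:R)))
  (XW_indep : forall m : k.-tuple nat, weight m = k ->
     independent (cond_prob Pr (M @^-1` [set m]))
       (first_terms (nblocks m) X) (first_terms (nblocks m) W))
  (d : nat) (A : 'I_d.+1 -> set Omega)
  (mA : forall i, measurable (A i)) (tA : trivIset setT A)
  (UA : \bigcup_(i in setT) A i = setT).

Let alpha_ i : R := fine (alpha (A i)).

Let alpha_fin i : alpha (A i) = (alpha_ i)%:E.
Proof.
rewrite fineK// ge0_fin_numE ?measure_ge0//.
apply: (@le_lt_trans _ _ (alpha setT)); last by rewrite alphaT ltry.
by rewrite le_measure ?inE.
Qed.

Let alpha_sum : \sum_i alpha_ i = a.
Proof.
apply: EFin_inj; rewrite -alphaT -UA -sumEFin.
rewrite -(_ : [set i : 'I_d.+1 | true] = setT); last by apply/seteqP.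
rewrite measure_bigcup_fintype//.
by apply: eq_bigr => i _; rewrite alpha_fin.
Qed.

Variables (idx : Omega -> 'I_d.+1) (AE : forall i x, A i x <-> idx x = i).

(** The vector built from a fixed [m], defined everywhere; it agrees with the vector of interest on
    the event that [M] equals [m]. *)
Let law_given (m : k.-tuple nat) (w : T) : d.+1.-tuple R :=
  aggregate (fun t : 'I_(nblocks m) => idx (X t w)) (first_terms (nblocks m) W w).

Let allocation_event (m : k.-tuple nat) (C : set (d.+1.-tuple R))
    (c : {ffun 'I_(nblocks m) -> 'I_d.+1}) : set T :=
  [set w | forall t : 'I_(nblocks m), A (c t) (X t w)] `&`
  first_terms (nblocks m) W @^-1` (aggregate c @^-1` C).

(** Splitting by the cells of the atoms replaces the random allocation by a constant [c], along
    which aggregation is deterministic. *)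
Let law_given_preimage m C : law_given m @^-1` C =
  \bigcup_(c in [set c : {ffun 'I_(nblocks m) -> 'I_d.+1} | true]) allocation_event C c.
Proof.
apply/seteqP; split=> [w /= Cw|w [c _ [/= Ac Cw]]].
  exists [ffun t : 'I_(nblocks m) => idx (X t w)] => //; split => /=.
    by move=> t; rewrite ffunE; apply/AE.
  move: Cw; rewrite /law_given; congr (C (aggregate _ _)).
  by apply/funext => t; rewrite ffunE.
move: Cw; rewrite /law_given; congr (C (aggregate _ _)).
by apply/funext => t; apply/esym/AE.
Qed.

Let measurable_allocation_event m C c : measurable C -> measurable (@allocation_event m C c).
Proof.
move=> mC; apply: measurableI.
  rewrite (_ : [set w | _] = \bigcap_(t in [set: 'I_(nblocks m)]) (X t @^-1` A (c t))).
    apply: fin_bigcap_measurable => [|t _]; first exact: finite_finset.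
    by rewrite -[X in measurable X]setTI; apply: measurable_funPT.
  by apply/seteqP; split=> w /= h t; [move=> _; exact: h|exact: h].
rewrite -[X in measurable X]setTI.
have mW : measurable_fun setT (first_terms (nblocks m) W).
  by apply: measurable_mktuple => i; exact: measurable_funPT.
by apply: mW => //; exact: measurable_preimage_aggregate.
Qed.

Let trivIset_allocation_event m C : trivIset setT (@allocation_event m C).
Proof.
apply/trivIsetP => c c' _ _ /eqP cc'; apply/seteqP; split=> // w /= [[h _] [h' _]].
apply: cc'; apply/ffunP => t.
by have /AE <- := h t; have /AE <- := h' t.
Qed.

(** The factor 1 / a of each block is left out, to be matched later with the power of [a] in the
    Ewens weight; [fine] gives the real value that [ewens_assignments] works with. *)
Let allocation_mass (m : k.-tuple nat) C (c : {ffun 'I_(nblocks m) -> 'I_d.+1}) : R :=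
  (\prod_t alpha_ (c t)) *
  fine (dirichlet (fun i => (block_count (@block_sizes k m) c i)%:R) C).

(** [allocation_prob] gives the conditional probability, [dirichlet_aggregate] rewrites the factor
    of [W], and multiplying by the positive Ewens weight removes the conditioning. *)
Let allocation_event_prob m C c : weight m = k -> measurable C ->
  Pr (@allocation_event m C c `&` M @^-1` [set m]) =
  (ewens_pmf a m * (a^-1 ^+ nblocks m * allocation_mass C c))%:E.
Proof.
move=> mk mC; have b0 : (0 < \sum_t block_sizes (m := m) t)%N by rewrite sum_block_sizes mk.
have e0 := ewens_pmf_gt0 m a_gt0.
have := allocation_prob c (X_iid mk) (W_dirichlet mk) (XW_indep mk) mA
  (measurable_preimage_aggregate c mC).
rewrite -/(allocation_event C c) /cond_prob M_ewens// inver gt_eqF// dirichlet_aggregate//.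
rewrite (eq_bigr (fun t => (alpha_ (c t) / a)%:E)); last first.
  by move=> t _; rewrite alpha_fin inver gt_eqF.
rewrite prodEFin big_split /= prodr_const card_ord.
rewrite -[dirichlet _ C]fineK ?dirichlet_fin_num ?sum_block_count// -EFinM => h.
rewrite [ewens_pmf a m * _]mulrC EFinM /allocation_mass mulrCA mulrA -h -muleA -EFinM.
by rewrite mulVf ?mule1// gt_eqF.
Qed.

Let prob_given m C : weight m = k -> measurable C ->
  Pr (law_given m @^-1` C `&` M @^-1` [set m]) =
  (ewens_pmf a m * (a^-1 ^+ nblocks m * \sum_c allocation_mass (m := m) C c))%:E.
Proof.
move=> mk mC; rewrite law_given_preimage setI_bigcupl measure_bigcup_fintype.
- rewrite mulr_sumr mulr_sumr -sumEFin; apply: eq_bigr => c _.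
  exact: allocation_event_prob.
- move=> c; apply: measurableI; first exact: measurable_allocation_event.
  by rewrite -[X in measurable X]setTI; apply: measurable_funPT => //; exact: measurable_tuple_nat_set1.
- exact/trivIset_setIr/trivIset_allocation_event.
Qed.

Let measurable_law_given m C : measurable C -> measurable (law_given m @^-1` C).
Proof.
move=> mC; rewrite law_given_preimage; apply: fin_bigcup_measurable => [|c _].
  exact: finite_finset.
exact: measurable_allocation_event.
Qed.

Let measurable_M (S : set (k.-tuple nat)) : measurable (M @^-1` S).
Proof.
rewrite -[X in measurable X]setTI; apply: measurable_funPT => //.
apply: countable_measurable; first exact: measurable_tuple_nat_set1.
exact: countableP.
Qed.

Let law (w : T) : d.+1.-tuple R := law_given (M w) w.

(** The union runs over all tuples, of any weight; they are countably many, which yields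
    measurability. *)
Let law_preimage C : law @^-1` C =
  \bigcup_m (law_given m @^-1` C `&` M @^-1` [set m]).
Proof.
by apply/seteqP; split=> [w Cw|w [m _ [Cw /= mE]]]; [exists (M w)|rewrite /law /= mE].
Qed.

Let measurable_law C : measurable C -> measurable (law @^-1` C).
Proof.
move=> mC; rewrite law_preimage; apply: countable_bigcupT_measurable => [|m].
  exact: countableP.
by apply: measurableI; [exact: measurable_law_given|exact: measurable_M].
Qed.

Let prob_law C : measurable C -> Pr (law @^-1` C) =
  (\sum_(f : {ffun 'I_k -> 'I_k.+1} | weight (tuple_of_ffun f) == k)
     ewens_pmf a (tuple_of_ffun f) * (a^-1 ^+ nblocks (tuple_of_ffun f) *
       \sum_c allocation_mass (m := tuple_of_ffun f) C c))%:E.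
Proof.
move=> mC; pose G f := law_given (tuple_of_ffun f) @^-1` C `&`
  M @^-1` [set (tuple_of_ffun f : k.-tuple nat)].
(* Tuples of a weight other than [k] occur with probability 0; the remaining ones are indexed by
   finite functions, which leaves a finite sum. *)
pose N : set T := M @^-1` [set m | weight m <> k].
have N0 : Pr N = 0%E.
  by apply: measure_negligible; [exact: measurable_M|exact: M_weight].
have mG (f : {ffun 'I_k -> 'I_k.+1}) : measurable (G k.+1 f).
  by apply: measurableI; [exact: measurable_law_given|exact: measurable_M].
have -> : law @^-1` C =
    \bigcup_(f in [set f : {ffun 'I_k -> 'I_k.+1} | weight (tuple_of_ffun f) == k]) G _ f
    `|` (law @^-1` C `&` N).
  apply/seteqP; split=> [w Cw|w].
    have [mk|mk] := eqVneq (weight (M w)) k; last by right; split=> //; apply/eqP.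
    left; have [f mE] := weight_tuple_of_ffun mk.
    by exists f; [rewrite /= -mE mk|rewrite /G -mE].
  by case=> [[f _ [Cw mE]]|[//]]; rewrite /law /= mE.
rewrite measureU0.
- rewrite measure_bigcup_fintype//.
    rewrite -sumEFin; apply: eq_bigr => f /eqP mk; exact: prob_given.
  apply/trivIsetP => f g _ _ /eqP fg; apply/seteqP; split=> // w /= [[_ /= mf] [_ /= mg]].
  by apply: fg; apply: tuple_of_ffun_inj; rewrite -mf -mg.
- by apply: fin_bigcup_measurable => // ; exact: finite_finset.
- by apply: measurableI; [exact: measurable_law|exact: measurable_M].
- apply/eqP; rewrite eq_le measure_ge0 andbT -N0 le_measure ?inE//.
  + by apply: measurableI; [exact: measurable_law|exact: measurable_M].
  + exact: measurable_M.
Qed.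

Let quasi_bernoulliE C : measurable C ->
  Pr (law @^-1` C) = quasi_bernoulli k alpha_ C.
Proof.
move=> mC; rewrite prob_law//.
have Dfin (b : 'I_d.+1 -> nat) : (\sum_i b i = k)%N ->
    dirichlet (fun i => (b i)%:R) C = (fine (dirichlet (fun i => (b i)%:R) C))%:E :> \bar R.
  by move=> bk; rewrite fineK// dirichlet_fin_num// bk.
pose Phi (b : 'I_d.+1 -> nat) := fine (dirichlet (fun i => (b i)%:R : R) C).
rewrite /quasi_bernoulli alpha_sum.
under [in RHS]eq_bigr => b /eqP bk do rewrite Dfin// -EFinM.
rewrite sumEFin -EFinM; congr EFin.
(* The combinatorial identity is applied with [Phi b] equal to the mass that D(b) gives to [C]. *)
have := ewens_assignments k alpha_ Phi; rewrite /Phi /= => <-.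
rewrite mulr_sumr; apply: eq_bigr => f /eqP mk.
rewrite /ewens_pmf -/(nblocks _).
have -> : ((\prod_(j < k) (j.+1 ^ tnth (tuple_of_ffun f) j *
    (tnth (tuple_of_ffun f) j)`!))%N%:R = \prod_(j < k) (j.+1 ^ f j * (f j)`!)%N%:R :> R).
  by rewrite natr_prod; apply: eq_bigr => j _; rewrite tnth_mktuple.
set S := \sum_c _; set p := \prod_(j < k) _.
(* The power of [a] in the Ewens weight cancels the normalization of the laws of the [X t]. *)
have an : a ^+ nblocks (tuple_of_ffun f) * a^-1 ^+ nblocks (tuple_of_ffun f) = 1.
  by rewrite -exprMn divff ?expr1n// gt_eqF.
transitivity (k`!%:R / p * (poch a k)^-1 *
  (a ^+ nblocks (tuple_of_ffun f) * a^-1 ^+ nblocks (tuple_of_ffun f)) * S).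
  by ring.
by rewrite an /S; ring.
Qed.

Lemma quasi_bernoulli_law : has_law Pr law (quasi_bernoulli k alpha_).
Proof.
split=> [_ C mC|C mC]; last exact: quasi_bernoulliE.
by rewrite setTI; exact: measurable_law.
Qed.

End conditioning.

(* Only the X_t, W_t with t < S_k = nblocks (M w) are relevant at w: the
   variables of larger index are unconstrained. *)
Theorem theorem5p1 (R : realType)
  (dO : measure_display) (Omega : measurableType dO)
  (alpha : {measure set Omega -> \bar R}) (a : R)
  (alphaT : alpha [set: Omega] = a%:E) (a_gt0 : 0 < a)
  (k : nat) (k_gt0 : (0 < k)%N)
  (dT : measure_display) (T : measurableType dT) (Pr : probability T R)
  (M : {RV Pr >-> k.-tuple nat})
  (X : nat -> {RV Pr >-> Omega}) (W : nat -> {RV Pr >-> R})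
  (M_weight : {ae Pr, forall w, weight (M w) = k})
  (M_ewens : forall m : k.-tuple nat, weight m = k ->
     Pr (M @^-1` [set m]) = (ewens_pmf a m)%:E)
  (X_iid : forall m : k.-tuple nat, weight m = k ->
     iid (cond_prob Pr (M @^-1` [set m])) (fun t : 'I_(nblocks m) => X t)
       (fun A => alpha A / a%:E)%E)
  (W_dirichlet : forall m : k.-tuple nat, weight m = k ->
     has_law (cond_prob Pr (M @^-1` [set m])) (first_terms (nblocks m) W)
       (dirichlet (fun t => (block_sizes t)%:R)))
  (XW_indep : forall m : k.-tuple nat, weight m = k ->
     independent (cond_prob Pr (M @^-1` [set m]))
       (first_terms (nblocks m) X) (first_terms (nblocks m) W))
  (d : nat) (A : 'I_d.+1 -> set Omega)
  (mA : forall i, measurable (A i)) (tA : trivIset setT A)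
  (UA : \bigcup_(i in setT) A i = setT) :
  let P (w : T) := weighted_dirac (first_terms (nblocks (M w)) W w)
                                  (first_terms (nblocks (M w)) X w) in
  has_law Pr (fun w => [tuple fine (P w (A i)) | i < d.+1])
    (quasi_bernoulli k (fun i => fine (alpha (A i)))).
Proof.
have [idx AE] := partition_index tA UA.
rewrite /=; set V := (X in has_law _ X _).
(* The masses of the cells are the weights aggregated along the cells of the atoms, that is [law] of
   the preceding section. *)
have -> : V = fun w => aggregate (fun t : 'I_(nblocks (M w)) => idx (X t w))
    (first_terms (nblocks (M w)) W w).
  apply/funext => w; apply: eq_from_tnth => i.
  rewrite tnth_mktuple (fine_weighted_dirac _ _ AE).
  congr (tnth (aggregate _ _) _); apply/funext => t.
  by rewrite tnth_mktuple.
exact: (quasi_bernoulli_law alphaT a_gt0 k_gt0 M_weight M_ewens X_iid W_dirichlet XW_indep mA tA UA AE).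
Qed.
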